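(* Let $0<\varepsilon\le1$ with $\gamma_\varepsilon\ge8L$. For every $T>0$ and $u_0\in\mathcal H$, $$\sup_{0\le t\le T}\|R_\varepsilon S(t)u_0-S_\varepsilon^{\mathcal M}(t)R_\varepsilon u_0\|_{\mathcal H}\le c_\varepsilon\left[\frac{L\bigl(e^{LT}-e^{-\lambda_\varepsilon^+T}\bigr)}{L+\lambda_\varepsilon^+}\|Q_\varepsilon u_0\|_{\mathcal H}+(e^{LT}-1)\,d_\varepsilon\right].$$ Consequently, for every bounded $B\subset\mathcal H$ and every $T>0$ there is a constant $C_{B,T}$, independent of $\varepsilon$, such that $$\sup_{u_0\in B}\ \sup_{0\le t\le T}\|R_\varepsilon S(t)u_0-S_\varepsilon^{\mathcal M}(t)R_\varepsilon u_0\|_{\mathcal H}\le C_{B,T}\,\varepsilon^2.$$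
   Context: $\mathcal H$ is an infinite-dimensional real Hilbert space and $A:\mathrm D(A)\subset\mathcal H\to\mathcal H$ is a nonnegative self-adjoint operator with compact resolvent. The map $F:\mathcal H\to\mathcal H$ satisfies, for constants $M,L>0$, $\|F(u)\|_{\mathcal H}\le M$ and $\|F(u)-F(w)\|_{\mathcal H}\le L\|u-w\|_{\mathcal H}$ for all $u,w\in\mathcal H$. Fix $\mu>0$. For $0<\varepsilon\le1$ let $\Lambda_\varepsilon=\mu\varepsilon^{-2}$, $P_\varepsilon=\mathbf 1_{[0,\Lambda_\varepsilon]}(A)$, $Q_\varepsilon=I-P_\varepsilon$, $A_\varepsilon=A+\varepsilon^{-1}Q_\varepsilon$ with $\mathrm D(A_\varepsilon)=\mathrm D(A)$. Put $\beta_\varepsilon=\sup\sigma(A|_{P_\varepsilon\mathcal H})$ ($=0$ if $P_\varepsilon\mathcal H=\{0\}$), $\lambda_\varepsilon^+=\inf\sigma(A|_{Q_\varepsilon\mathcal H})$, $\alpha_\varepsilon=\lambda_\varepsilon^++\varepsilon^{-1}$, $\gamma_\varepsilon=\alpha_\varepsilon-\beta_\varepsilon$. $S(t)$ and $S_\varepsilon(t)$ are the semiflows on $\mathcal H$ of global mild solutions of $\dot v+Av=F(v)$ and $\dot v^\varepsilon+A_\varepsilon v^\varepsilon=F(v^\varepsilon)$, respectively. Whenever $\gamma_\varepsilon\ge8L$, $\mathcal M_\varepsilon=\{p+h_\varepsilon(p):p\in P_\varepsilon\mathcal H\}$ denotes the inertial manifold of $S_\varepsilon(t)$ given by classical theory,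 with $h_\varepsilon:P_\varepsilon\mathcal H\to Q_\varepsilon\mathcal H$, $\|h_\varepsilon\|_{L^\infty}\le M/\alpha_\varepsilon$, $\operatorname{Lip}(h_\varepsilon)\le4L/\gamma_\varepsilon$, $S_\varepsilon(t)\mathcal M_\varepsilon=\mathcal M_\varepsilon$ for $t\ge0$, and dynamics on $\mathcal M_\varepsilon$ governed by $\dot p+Ap=P_\varepsilon F(p+h_\varepsilon(p))$ for $p\in P_\varepsilon\mathcal H$. Write $S_\varepsilon^{\mathcal M}(t)=S_\varepsilon(t)|_{\mathcal M_\varepsilon}$ and define the retraction $R_\varepsilon:\mathcal H\to\mathcal M_\varepsilon$, $R_\varepsilon u=P_\varepsilon u+h_\varepsilon(P_\varepsilon u)$. Finally $c_\varepsilon=\sqrt{1+16L^2/\gamma_\varepsilon^2}$ and $d_\varepsilon=M/\lambda_\varepsilon^++M/\alpha_\varepsilon$. *)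

(* Defs.v *)
From Stdlib Require Import Reals ClassicalEpsilon.
From Coquelicot Require Import Coquelicot.
Open Scope R_scope.

Set Implicit Arguments.
Unset Strict Implicit.

(** * Real Hilbert spaces *)

(** A real Hilbert space is a complete normed module over [R] whose norm comes
    from an inner product; definiteness follows from that of [norm]. *)
Record inner_product (H : NormedModule R_AbsRing) (ip : H -> H -> R) : Prop := {
  ip_sym  : forall u v, ip u v = ip v u;
  ip_plus : forall u v w, ip (plus u v) w = ip u w + ip v w;
  ip_scal : forall (a : R) u v, ip (scal a u) v = a * ip u v;
  ip_norm : forall u, ip u u = norm u ^ 2
}.

(** [sum_n a n] has the [n + 1] terms [a 0, ..., a n]. *)
Definition infinite_dimensional (H : NormedModule R_AbsRing) : Prop :=
  ~ exists (n : nat) (e : nat -> H),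
      forall u : H, exists c : nat -> R,
        u = sum_n (fun k => scal (c k) (e k)) n.

Definition bounded_set (H : NormedModule R_AbsRing) (B : H -> Prop) : Prop :=
  exists r : R, forall u, B u -> norm u <= r.

Definition dense (H : NormedModule R_AbsRing) (D : H -> Prop) : Prop :=
  forall (u : H) (eta : R), 0 < eta -> exists v, D v /\ norm (minus u v) < eta.

Definition range (H : NormedModule R_AbsRing) (P : H -> H) (u : H) : Prop :=
  exists w, u = P w.

Definition compl (H : NormedModule R_AbsRing) (P : H -> H) (u : H) : H :=
  minus u (P u).

(** * Unbounded operators *)

(** The values of [op] outside [dom] are irrelevant. *)
Record operator (H : NormedModule R_AbsRing) := Operator {
  dom : H -> Prop;
  op :> H -> H
}.

Record linear_operator (H : NormedModule R_AbsRing) (A : operator H) : Prop := {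
  dom_zero : dom A zero;
  dom_plus : forall u v, dom A u -> dom A v -> dom A (plus u v);
  dom_scal : forall (a : R) u, dom A u -> dom A (scal a u);
  op_plus  : forall u v, dom A u -> dom A v -> A (plus u v) = plus (A u) (A v);
  op_scal  : forall (a : R) u, dom A u -> A (scal a u) = scal a (A u)
}.

(** [(v, w)] belongs to the graph of the adjoint of [A]. *)
Definition adjoint_graph (H : NormedModule R_AbsRing) (ip : H -> H -> R)
    (A : operator H) (v w : H) : Prop :=
  forall u, dom A u -> ip (A u) v = ip u w.

Record self_adjoint (H : NormedModule R_AbsRing) (ip : H -> H -> R)
    (A : operator H) : Prop := {
  sa_linear : linear_operator A;
  sa_dense  : dense (dom A);
  sa_adjoint : forall v w, adjoint_graph ip A v w <-> (dom A v /\ A v = w)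
}.

Definition nonnegative (H : NormedModule R_AbsRing) (ip : H -> H -> R)
    (A : operator H) : Prop :=
  forall u, dom A u -> 0 <= ip (A u) u.

(** [G] restricted to [V] is the bounded inverse of [A - lam], where [A] is
    regarded as an operator in the subspace [V] with domain [dom A] cap [V]. *)
Record resolvent_on (H : NormedModule R_AbsRing) (A : operator H)
    (V : H -> Prop) (lam : R) (G : H -> H) : Prop := {
  res_dom   : forall u, V u -> V (G u) /\ dom A (G u);
  res_right : forall u, V u -> minus (A (G u)) (scal lam (G u)) = u;
  res_left  : forall u, V u -> dom A u -> V (minus (A u) (scal lam u)) /\
                G (minus (A u) (scal lam u)) = u;
  res_bound : exists C : R, forall u, V u -> norm (G u) <= C * norm u
}.

(** The spectrum of the part of [A] in [V]; real points suffice because it is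
    only used for self-adjoint operators. *)
Definition spectrum_on (H : NormedModule R_AbsRing) (A : operator H)
    (V : H -> Prop) (lam : R) : Prop :=
  ~ exists G : H -> H, resolvent_on A V lam G.

Definition compact_operator (H : NormedModule R_AbsRing) (G : H -> H) : Prop :=
  is_linear G /\
  forall u : nat -> H, (exists r : R, forall n, norm (u n) <= r) ->
    exists (phi : nat -> nat) (l : H),
      (forall n, (phi n < phi (S n))%nat) /\
      filterlim (fun n => G (u (phi n))) eventually (locally l).

Definition compact_resolvent (H : NormedModule R_AbsRing) (A : operator H)
    : Prop :=
  exists (lam : R) (G : H -> H),
    resolvent_on A (fun _ => True) lam G /\ compact_operator G.

(** [G = f(A)] for a self-adjoint [A] with compact resolvent and [f] bounded on
    the spectrum.  The spectrum consists of eigenvalues and [H] is the Hilbert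
    sum of the eigenspaces of [A], so [f(A)] is the bounded operator that
    multiplies each eigenspace [ker (A - lam)] by [f lam]. *)
Definition functional_calculus (H : NormedModule R_AbsRing) (A : operator H)
    (f : R -> R) (G : H -> H) : Prop :=
  is_linear G /\
  forall (lam : R) (e : H),
    dom A e -> A e = scal lam e -> G e = scal (f lam) e.

Definition indicator (a b x : R) : R :=
  if Rle_dec a x then (if Rle_dec x b then 1 else 0) else 0.

(** * Mild solutions *)

(** [t |-> v t], [t >= 0], is the global mild solution of [v' + A v = F v] with
    [v 0 = u0], where [E t] stands for [exp (- t A)]; the integral is the
    [H]-valued Riemann integral of a continuous function. *)
Definition mild_solution (H : NormedModule R_AbsRing) (E : R -> H -> H)
    (F : H -> H) (u0 : H) (v : R -> H) : Prop :=
  (forall t, 0 <= t ->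
     filterlim v (within (fun s => 0 <= s) (locally t)) (locally (v t))) /\
  (forall t, 0 <= t ->
     exists I : H, is_RInt (fun s => E (t - s) (F (v s))) 0 t I /\
       v t = plus (E t u0) I).

Definition mild_semiflow (H : NormedModule R_AbsRing) (A : operator H)
    (F : H -> H) (S : R -> H -> H) : Prop :=
  exists E : R -> H -> H,
    (forall t, 0 <= t ->
       functional_calculus A (fun lam => exp (- t * lam)) (E t)) /\
    (forall u0, mild_solution E F u0 (fun t => S t u0)).

(** * The regularised operator and the associated constants

    In what follows [P] is the spectral projection for the parameter [eps]. *)

Definition Lambda (mu eps : R) : R := mu / eps ^ 2.

Definition A_eps (H : NormedModule R_AbsRing) (A : operator H) (P : H -> H)
    (eps : R) : operator H :=
  Operator (dom A) (fun u => plus (A u) (scal (/ eps) (compl P u))).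

Definition beta (H : NormedModule R_AbsRing) (A : operator H) (P : H -> H) : R :=
  if excluded_middle_informative (forall u, P u = zero) then 0
  else real (Lub_Rbar (spectrum_on A (range P))).

Definition lambda_plus (H : NormedModule R_AbsRing) (A : operator H)
    (P : H -> H) : R :=
  real (Glb_Rbar (spectrum_on A (range (compl P)))).

Definition alpha (H : NormedModule R_AbsRing) (A : operator H) (P : H -> H)
    (eps : R) : R :=
  lambda_plus A P + / eps.

Definition gamma (H : NormedModule R_AbsRing) (A : operator H) (P : H -> H)
    (eps : R) : R :=
  alpha A P eps - beta A P.

Definition c_eps (H : NormedModule R_AbsRing) (A : operator H) (P : H -> H)
    (L eps : R) : R :=
  sqrt (1 + 16 * L ^ 2 / gamma A P eps ^ 2).

Definition d_eps (H : NormedModule R_AbsRing) (A : operator H) (P : H -> H)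
    (M eps : R) : R :=
  M / lambda_plus A P + M / alpha A P eps.

(** * The inertial manifold *)

(** Only the values of [h] on [range P] matter. *)
Definition manifold (H : NormedModule R_AbsRing) (P h : H -> H) (u : H) : Prop :=
  exists p, range P p /\ u = plus p (h p).

Definition retraction (H : NormedModule R_AbsRing) (P h : H -> H) (u : H) : H :=
  plus (P u) (h (P u)).

(** [S] is the semiflow generated by [A_eps] and [F].  [im_attract] is the
    exponential attraction that is part of the notion of inertial manifold. *)
Record inertial_manifold (H : NormedModule R_AbsRing) (A : operator H)
    (F : H -> H) (M L eps : R) (P : H -> H) (S : R -> H -> H) (h : H -> H)
    : Prop := {
  im_range : forall p, range P p -> range (compl P) (h p);
  im_bound : forall p, range P p -> norm (h p) <= M / alpha A P eps;
  im_lip : forall p q, range P p -> range P q ->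
    norm (minus (h p) (h q)) <= 4 * L / gamma A P eps * norm (minus p q);
  im_invariant : forall t, 0 <= t -> forall u,
    manifold P h u <-> exists w, manifold P h w /\ u = S t w;
  im_dynamics : forall u0, manifold P h u0 -> forall t, 0 < t ->
    let p := fun s => P (S s u0) in
    dom A (p t) /\
    is_derive p t (minus (P (F (plus (p t) (h (p t))))) (A (p t)));
  im_attract : exists omega, 0 < omega /\
    forall B, bounded_set B -> exists K, forall u0 t, B u0 -> 0 <= t ->
      exists w, manifold P h w /\
        norm (minus (S t u0) w) <= K * exp (- omega * t)
}.

(* Main.v *)
Require Import Defs.
From Stdlib Require Import ssreflect.
From Stdlib Require Import Reals Lra Lia List ClassicalEpsilon.
From Coquelicot Require Import Coquelicot.
Open Scope R_scope.

(** The spectral theorem enters only through a comparison principle: if [F = f(A)] and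
    [G = g(A)] with [|f| <= |g|] on the eigenvalues of [A], then [|F x| <= |G x|] for all [x].
    It holds for finite orthogonal sums of eigenvectors by Pythagoras, and these are dense: as the
    resolvent [K] of [A] is compact and symmetric, finitely many of its eigenvectors can be split
    off so that [K] has norm at most [eta] on their orthogonal complement.

    Comparison yields that [P] is an orthogonal projection commuting with [A], that
    [P exp(- t A_eps) = P exp(- t A)] is a contraction, that [A >= Lambda] on [Q H] (so that
    [lambda_plus >= Lambda]), and that [exp(- t A)] decays like [exp(- lambda_plus t)] on [Q H].
    By Duhamel's formula [|Q S(t) u0| <= exp(- lambda_plus t) |Q u0| + M / lambda_plus].  Since
    [S_eps(t) R u0] stays on the manifold, its [Q]-part is bounded by [M / alpha], and subtracting
    the [P]-parts of the two Duhamel formulas gives for their difference [delta]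
    [[
      |delta t| <= L * int_0^t (|delta s| + exp(- lambda_plus s) |Q u0| + d_eps) ds.
    ]]
    Gronwall's lemma bounds [|delta|], and Pythagoras with the Lipschitz bound of [h] turns this into
    a bound on [R S(t) u0 - S_eps(t) R u0] at the cost of the factor [c_eps]. *)

(** * Inner products *)

Section InnerProduct.
Context {H : NormedModule R_AbsRing} {ip : H -> H -> R} (hip : inner_product ip).

Lemma norm_zero_eq (u : H) : norm u = 0 -> u = zero.
Proof. exact (norm_eq_zero u). Qed.

Lemma ip_plus_r u v w : ip u (plus v w) = ip u v + ip u w.
Proof.
  rewrite (ip_sym hip) (ip_plus hip) (ip_sym hip v) (ip_sym hip w); reflexivity.
Qed.

Lemma ip_scal_r (a : R) u v : ip u (scal a v) = a * ip u v.
Proof. rewrite (ip_sym hip) (ip_scal hip) (ip_sym hip v); reflexivity. Qed.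

Lemma ip_opp_l u v : ip (opp u) v = - ip u v.
Proof.
  replace (opp u) with (scal (opp one : R) u) by exact (scal_opp_one u).
  rewrite (ip_scal hip). unfold opp, one; simpl. ring.
Qed.

Lemma ip_opp_r u v : ip u (opp v) = - ip u v.
Proof. rewrite (ip_sym hip) ip_opp_l (ip_sym hip v); reflexivity. Qed.

Lemma ip_zero_l u : ip zero u = 0.
Proof.
  replace (zero : H) with (scal (zero : R) (zero : H)) by exact (scal_zero_l _).
  rewrite (ip_scal hip). unfold zero; simpl. ring.
Qed.

Lemma ip_zero_r u : ip u zero = 0.
Proof. rewrite (ip_sym hip); apply ip_zero_l. Qed.

Lemma ip_minus_l u v w : ip (minus u v) w = ip u w - ip v w.
Proof. unfold minus. rewrite (ip_plus hip) ip_opp_l. ring. Qed.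

Lemma ip_minus_r u v w : ip u (minus v w) = ip u v - ip u w.
Proof. unfold minus. rewrite ip_plus_r ip_opp_r. ring. Qed.

Lemma ip_ext u v : (forall w, ip u w = ip v w) -> u = v.
Proof.
  intros E.
  assert (Z : minus u v = zero).
  { apply norm_zero_eq. generalize (ip_norm hip (minus u v)).
    rewrite ip_minus_l E. intros e.
    assert (e' : norm (minus u v) * norm (minus u v) = 0) by (simpl in e; lra).
    apply Rmult_integral in e'; tauto. }
  transitivity (plus v (minus u v)).
  - unfold minus. rewrite (plus_comm u) plus_assoc.
    symmetry. transitivity (plus (zero : H) u); [f_equal; apply (plus_opp_r v) | apply (plus_zero_l u)].
  - rewrite Z. apply plus_zero_r.
Qed.
End InnerProduct.

Ltac ip_expand hip :=
  repeat (rewrite ?(ip_plus hip) ?(ip_plus_r hip) ?(ip_scal hip) ?(ip_scal_r hip)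
    ?(ip_minus_l hip) ?(ip_minus_r hip) ?(ip_opp_l hip) ?(ip_opp_r hip)
    ?(ip_zero_l hip) ?(ip_zero_r hip)).

(* Vector identities are checked against an arbitrary test vector, which turns them into
   ring identities. *)
Ltac vec hip := apply (ip_ext hip); intros ?w; ip_expand hip; try ring.

(* Unlike [replace], [rewrite] identifies the various canonical structures on [H]. *)
Tactic Notation "vreplace" constr(u) "with" constr(v) "by" constr(hip) :=
  let E := fresh in assert (E : u = v) by (vec hip); rewrite E; clear E.

(** * Norm identities and the Cauchy-Schwarz inequality *)

Section NormIdentities.
Context {H : NormedModule R_AbsRing} {ip : H -> H -> R} (hip : inner_product ip).

Lemma norm_scal_R (a : R) (u : H) : norm (scal a u) = Rabs a * norm u.
Proof.
  apply Rsqr_inj.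
  - apply norm_ge_0.
  - apply Rmult_le_pos; [apply Rabs_pos | apply norm_ge_0].
  - rewrite Rsqr_mult -Rsqr_abs. unfold Rsqr.
    generalize (ip_norm hip (scal a u)) (ip_norm hip u).
    ip_expand hip. simpl. intros e1 e2. rewrite e2 in e1.
    transitivity (a * (a * (norm u * (norm u * 1)))); [lra | ring].
Qed.

Lemma norm_sq_plus u v : norm (plus u v) ^ 2 = norm u ^ 2 + 2 * ip u v + norm v ^ 2.
Proof.
  rewrite -!(ip_norm hip). ip_expand hip. rewrite (ip_sym hip v u). ring.
Qed.

Lemma norm_sq_minus u v : norm (minus u v) ^ 2 = norm u ^ 2 - 2 * ip u v + norm v ^ 2.
Proof.
  rewrite -!(ip_norm hip). ip_expand hip. rewrite (ip_sym hip v u). ring.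
Qed.

(** The triangle inequality is already part of the normed module; squaring it and comparing with the
    expansion of [norm (plus u v) ^ 2] leaves exactly Cauchy-Schwarz. *)
Lemma ip_le u v : ip u v <= norm u * norm v.
Proof.
  pose proof (norm_triangle u v). pose proof (norm_ge_0 (plus u v)).
  pose proof (norm_sq_plus u v).
  pose proof (norm_ge_0 u). pose proof (norm_ge_0 v). nra.
Qed.

Lemma ip_abs_le u v : Rabs (ip u v) <= norm u * norm v.
Proof.
  apply Rabs_le; split; [|apply ip_le].
  generalize (ip_le (opp u) v). rewrite (ip_opp_l hip) norm_opp. lra.
Qed.
Lemma norm_minus_sym (u v : H) : norm (minus u v) = norm (minus v u).
Proof. rewrite -norm_opp. f_equal. vec hip. Qed.

Lemma norm_minus_triangle (u v w : H) : norm (minus u w) <= norm (minus u v) + norm (minus v w).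
Proof.
  vreplace (minus u w) with (plus (minus u v) (minus v w)) by hip.
  apply norm_triangle.
Qed.

Lemma norm_le_minus (u v : H) : norm u <= norm v + norm (minus u v).
Proof.
  assert (E : u = plus v (minus u v)) by vec hip.
  rewrite {1}E. apply norm_triangle.
Qed.

Lemma ip_zero_closed e x :
  (forall eta, 0 < eta -> exists y, ip e y = 0 /\ norm (minus x y) < eta) -> ip e x = 0.
Proof.
  intros A. destruct (Req_dec (ip e x) 0) as [|N]; [assumption|exfalso].
  (* The [+ 1] keeps the radius meaningful when [e] is zero. *)
  assert (K : 0 < Rabs (ip e x) / (norm e + 1)).
  { apply Rdiv_lt_0_compat; [apply Rabs_pos_lt, N | pose proof (norm_ge_0 e); lra]. }
  destruct (A _ K) as [y [E B]].
  pose proof (ip_abs_le e (minus x y)) as C.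
  rewrite (ip_minus_r hip) E Rminus_0_r in C.
  pose proof (norm_ge_0 e).
  apply (Rmult_lt_compat_r (norm e + 1)) in B; [|lra].
  unfold Rdiv in B. rewrite Rmult_assoc (Rinv_l (norm e + 1)) ?Rmult_1_r in B; [|lra].
  pose proof (norm_ge_0 (minus x y)). nra.
Qed.

End NormIdentities.

(** * Convergence of sequences in norm *)

Definition tends {H : NormedModule R_AbsRing} (u : nat -> H) (l : H) : Prop :=
  forall eta, 0 < eta -> exists N, forall n, (N <= n)%nat -> norm (minus (u n) l) < eta.

Lemma tends_filterlim {H : NormedModule R_AbsRing} (u : nat -> H) (l : H) :
  filterlim u eventually (locally l) <-> tends u l.
Proof.
  split.
  - intros L eta h.
    apply (proj1 (@filterlim_locally_ball_norm _ _ _ eventually _ u l)) with (eps := mkposreal eta h) in L.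
    destruct L as [N L]. exists N. intros n hn. exact (L n hn).
  - intros T. apply filterlim_locally_ball_norm. intros [eta h].
    destruct (T eta h) as [N L]. exists N. intros n hn. exact (L n hn).
Qed.

Section Tends.
Context {H : NormedModule R_AbsRing} {ip : H -> H -> R} (hip : inner_product ip).

Lemma tends_linear (G : H -> H) u l : is_linear G -> tends u l -> tends (fun n => G (u n)) (G l).
Proof.
  intros hG T eta h. destruct (linear_norm _ hG) as [C [hC B]].
  destruct (T (eta / C)) as [N hN]; [apply Rdiv_lt_0_compat; lra|].
  exists N. intros n hn. rewrite -(linear_minus G _ _ hG).
  apply Rle_lt_trans with (1 := B _). apply hN in hn.
  apply (Rmult_lt_compat_l C) in hn; [|lra].
  replace (C * (eta / C)) with eta in hn by (field; lra). exact hn.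
Qed.

Lemma tends_unique u (l l' : H) : tends u l -> tends u l' -> l = l'.
Proof.
  intros T T'.
  assert (Z : norm (minus l l') = 0).
  { destruct (Rle_lt_dec (norm (minus l l')) 0) as [h|h].
    - apply Rle_antisym; [exact h | apply norm_ge_0].
    - exfalso. destruct (T (norm (minus l l') / 2)) as [N hN]; [lra|].
      destruct (T' (norm (minus l l') / 2)) as [N' hN']; [lra|].
      specialize (hN (N + N')%nat ltac:(lia)). specialize (hN' (N + N')%nat ltac:(lia)).
      pose proof (norm_minus_triangle hip l (u (N + N')%nat) l') as t.
      rewrite (norm_minus_sym hip l (u _)) in t. lra. }
  apply norm_zero_eq in Z.
  assert (E : l = plus (minus l l') l') by vec hip.
  rewrite E. rewrite Z. apply plus_zero_l.
Qed.

Lemma tends_plus u v (l l' : H) : tends u l -> tends v l' -> tends (fun n => plus (u n) (v n)) (plus l l').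
Proof.
  intros T T' eta h.
  destruct (T (eta / 2)) as [N hN]; [lra|]. destruct (T' (eta / 2)) as [N' hN']; [lra|].
  exists (N + N')%nat. intros n hn.
  specialize (hN n ltac:(lia)). specialize (hN' n ltac:(lia)).
  vreplace (minus (plus (u n) (v n)) (plus l l')) with (plus (minus (u n) l) (minus (v n) l')) by hip.
  eapply Rle_lt_trans; [apply norm_triangle | lra].
Qed.

Lemma tends_scal (a : R) u (l : H) : tends u l -> tends (fun n => scal a (u n)) (scal a l).
Proof.
  intros T eta h.
  destruct (T (eta / (Rabs a + 1))) as [N hN].
  { apply Rdiv_lt_0_compat; [lra | pose proof (Rabs_pos a); lra]. }
  exists N. intros n hn. specialize (hN n hn).
  vreplace (minus (scal a (u n)) (scal a l)) with (scal a (minus (u n) l)) by hip.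
  rewrite (norm_scal_R hip).
  pose proof (Rabs_pos a). pose proof (norm_ge_0 (minus (u n) l)).
  apply (Rmult_lt_compat_l (Rabs a + 1)) in hN; [|lra].
  replace ((Rabs a + 1) * (eta / (Rabs a + 1))) with eta in hN by (field; lra). nra.
Qed.

Lemma tends_norm u (l : H) c : tends u l ->
  (forall eta, 0 < eta -> exists N, forall n, (N <= n)%nat -> Rabs (norm (u n) - c) < eta) ->
  norm l = c.
Proof.
  intros T C.
  destruct (Req_dec (norm l) c) as [|N]; [assumption|exfalso].
  assert (K : 0 < Rabs (norm l - c)) by (apply Rabs_pos_lt; lra).
  destruct (T (Rabs (norm l - c) / 2)) as [N1 h1]; [lra|].
  destruct (C (Rabs (norm l - c) / 2)) as [N2 h2]; [lra|].
  specialize (h1 (N1 + N2)%nat ltac:(lia)). specialize (h2 (N1 + N2)%nat ltac:(lia)).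
  pose proof (norm_le_minus hip (u (N1 + N2)%nat) l) as t1.
  pose proof (norm_le_minus hip l (u (N1 + N2)%nat)) as t2.
  rewrite (norm_minus_sym hip l) in t2.
  revert h1 h2 K; unfold Rabs; repeat destruct Rcase_abs; lra.
Qed.

Lemma strict_mono_ge (phi : nat -> nat) : (forall n, (phi n < phi (S n))%nat) -> forall n, (n <= phi n)%nat.
Proof. intros h n; induction n; [lia|]. specialize (h n). lia. Qed.

End Tends.

(** * Compact symmetric operators *)

Section CompactSymmetric.
Context {H : NormedModule R_AbsRing} {ip : H -> H -> R} (hip : inner_product ip).

Definition ortho_to (l : list H) (x : H) : Prop := forall e, In e l -> ip e x = 0.

(** Abstracts the orthogonal complement of the eigenvectors found so far. Closedness keeps the limit
    of a maximizing sequence inside [V], and invariance keeps its images there. *)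
Record invariant_subspace (G : H -> H) (V : H -> Prop) : Prop := {
  inv_plus : forall x y, V x -> V y -> V (plus x y);
  inv_scal : forall (a : R) x, V x -> V (scal a x);
  inv_closed : forall x, (forall eta, 0 < eta -> exists y, V y /\ norm (minus x y) < eta) -> V x;
  inv_map : forall x, V x -> V (G x) }.

Lemma tends_in_closed (G : H -> H) (V : H -> Prop) u (l : H) :
  invariant_subspace G V -> (forall n : nat, V (u n)) -> tends u l -> V l.
Proof.
  intros hV U T. apply (inv_closed _ _ hV). intros eta h.
  destruct (T eta h) as [N hN]. exists (u N). split; [apply U|].
  rewrite (norm_minus_sym hip). apply hN, Nat.le_refl.
Qed.

Context (G : H -> H) (hG : compact_operator G) (hsym : forall x y, ip (G x) y = ip x (G y)).

(** Expanding the square, symmetry turns the cross term into [norm (G x) ^ 2]. If [norm (G x)] is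
    close to its supremum [m], the right side is small, so [x] is nearly an eigenvector of the
    square of [G]. *)
Lemma norm_maximizing_bound (m : R) (x : H) :
  norm x <= 1 -> norm (G (G x)) <= m * norm (G x) ->
  norm (minus (G (G x)) (scal (m ^ 2) x)) ^ 2 <= m ^ 2 * (m ^ 2 - norm (G x) ^ 2).
Proof.
  intros hx hGG. rewrite (norm_sq_minus hip) (ip_scal_r hip) hsym (ip_norm hip) (norm_scal_R hip).
  rewrite Rpow_mult_distr -RPow_abs.
  pose proof (norm_ge_0 x). pose proof (norm_ge_0 (G x)). pose proof (norm_ge_0 (G (G x))).
  assert (a1 : norm x ^ 2 <= 1) by nra.
  assert (a2 : norm (G (G x)) ^ 2 <= m ^ 2 * norm (G x) ^ 2).
  { rewrite -Rpow_mult_distr. apply pow_incr; lra. }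
  pose proof (pow2_ge_0 m) as a3.
  replace ((Rabs m ^ 2) ^ 2) with (m ^ 2 * m ^ 2) by (rewrite pow2_abs; ring).
  assert (m ^ 2 * m ^ 2 * norm x ^ 2 <= m ^ 2 * m ^ 2 * 1) by (apply Rmult_le_compat_l; nra).
  lra.
Qed.

(** Let [m] be the supremum of [norm (G x)] over the unit ball of [V]; the vector [x0] forces
    [eta < m]. Along a maximizing sequence [z], compactness makes [G (z n)] converge to some [y],
    and the preceding bound makes [z] itself converge to a vector [x] with [G x = y] and
    [G (G x) = scal (m ^ 2) x]. As [norm y = m], [x] is nonzero, and factoring yields an eigenvalue
    [m] or [- m]. *)
Lemma compact_symmetric_eigenvector (V : H -> Prop) (hV : invariant_subspace G V) (eta : R) (x0 : H) :
  0 < eta -> V x0 -> eta * norm x0 < norm (G x0) ->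
  exists (e : H) (lam : R), V e /\ e <> zero /\ eta <= Rabs lam /\ G e = scal lam e.
Proof.
  intros heta V0 h0. destruct hG as [hl hcomp].
  assert (nz : 0 < norm x0).
  { destruct (Req_dec (norm x0) 0) as [z|z]; [|pose proof (norm_ge_0 x0); lra].
    apply norm_zero_eq in z. subst x0.
    rewrite (linear_zero G hl) norm_zero in h0. lra. }
  set (E := fun r => exists x, V x /\ norm x <= 1 /\ r = norm (G x)).
  destruct (linear_norm _ hl) as [C [hC hCb]].
  destruct (completeness E) as [m [mub mlub]].
  { exists C. intros r (x & _ & nx & ->). specialize (hCb x). nra. }
  { exists (norm (G x0) / norm x0), (scal (/ norm x0) x0). split; [|split].
    - apply (inv_scal _ _ hV), V0.
    - rewrite (norm_scal_R hip) Rabs_pos_eq; [|left; apply Rinv_0_lt_compat, nz].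
      right; field; lra.
    - rewrite (linear_scal _ hl) (norm_scal_R hip) Rabs_pos_eq; [|left; apply Rinv_0_lt_compat, nz].
      field; lra. }
  assert (mb : forall x, V x -> norm (G x) <= m * norm x).
  { intros x Vx. destruct (Req_dec (norm x) 0) as [z|z].
    - apply norm_zero_eq in z. subst x. rewrite (linear_zero G hl) norm_zero; lra.
    - assert (z' : 0 < norm x) by (pose proof (norm_ge_0 x); lra).
      assert (B : norm (G x) / norm x <= m).
      { apply mub. exists (scal (/ norm x) x). split; [|split].
        - apply (inv_scal _ _ hV), Vx.
        - rewrite (norm_scal_R hip) Rabs_pos_eq; [|left; apply Rinv_0_lt_compat, z'].
          right; field; lra.
        - rewrite (linear_scal _ hl) (norm_scal_R hip) Rabs_pos_eq; [|left; apply Rinv_0_lt_compat, z'].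
          field; lra. }
      apply (Rmult_le_compat_r (norm x)) in B; [|lra].
      unfold Rdiv in B. rewrite Rmult_assoc Rinv_l ?Rmult_1_r in B; lra. }
  assert (hm : eta < m).
  { specialize (mb x0 V0). nra. }
  assert (S : forall n : nat, exists x, V x /\ norm x <= 1 /\ m - / INR (n + 1) < norm (G x)).
  { intros n. destruct (classic (exists x, V x /\ norm x <= 1 /\ m - / INR (n + 1) < norm (G x))) as [e|e];
      [exact e|exfalso].
    assert (p : 0 < / INR (n + 1)) by (apply Rinv_0_lt_compat, lt_0_INR; lia).
    enough (m <= m - / INR (n + 1)) by lra.
    apply mlub. intros r (x & Vx & nx & ->).
    apply Rnot_lt_le. intros c. apply e. exists x; auto. }
  apply choice in S. destruct S as [xs hxs].
  destruct (hcomp xs) as (phi & y & hphi & hy).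
  { exists 1. intros n; apply hxs. }
  apply tends_filterlim in hy.
  set (z := fun n => xs (phi n)).
  assert (Vz : forall n, V (z n)) by (intros n; apply hxs).
  assert (nz1 : forall n, norm (z n) <= 1) by (intros n; apply hxs).
  assert (gz : forall n, m - / INR (n + 1) < norm (G (z n))).
  { intros n. destruct (hxs (phi n)) as (_ & _ & h).
    apply Rle_lt_trans with (2 := h).
    pose proof (strict_mono_ge phi hphi n).
    assert (/ INR (phi n + 1) <= / INR (n + 1)); [|lra].
    apply Rinv_le_contravar; [apply lt_0_INR; lia | apply le_INR; lia]. }
  assert (gz' : forall n, norm (G (z n)) <= m).
  { intros n. specialize (mb _ (Vz n)). specialize (nz1 n). pose proof (norm_ge_0 (z n)). nra. }
  assert (T : tends (fun n => minus (G (G (z n))) (scal (m ^ 2) (z n))) zero).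
  { intros d hd.
    (* The constant is [m ^ 2] from the preceding bound times [2 * m], which bounds the factor
       [m + norm (G (z n))] of the difference of squares; the other factor is at most [/ INR N]. *)
    assert (p : 0 < 2 * m ^ 3) by (assert (0 < m ^ 3) by (apply pow_lt; lra); lra).
    destruct (archimed_cor1 (d ^ 2 / (2 * m ^ 3))) as [N [hN N0]].
    { apply Rdiv_lt_0_compat; [apply pow_lt|]; lra. }
    exists N. intros n hn.
    set (v := minus (G (G (z n))) (scal (m ^ 2) (z n))).
    vreplace (minus v zero) with v by hip.
    assert (B : norm v ^ 2 <= m ^ 2 * (m ^ 2 - norm (G (z n)) ^ 2)).
    { apply norm_maximizing_bound; [apply nz1 | apply mb, (inv_map _ _ hV), Vz]. }
    assert (q : / INR (n + 1) <= / INR N).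
    { apply Rinv_le_contravar; [apply lt_0_INR; lia | apply le_INR; lia]. }
    specialize (gz n). specialize (gz' n). pose proof (norm_ge_0 (G (z n))).
    assert (B2 : m ^ 2 - norm (G (z n)) ^ 2 <= / INR N * (2 * m)).
    { replace (m ^ 2 - norm (G (z n)) ^ 2) with ((m - norm (G (z n))) * (m + norm (G (z n)))) by ring.
      apply Rmult_le_compat; lra. }
    assert (B3 : norm v ^ 2 <= / INR N * (2 * m ^ 3)).
    { pose proof (pow2_ge_0 m). apply Rle_trans with (1 := B).
      replace (/ INR N * (2 * m ^ 3)) with (m ^ 2 * (/ INR N * (2 * m))) by ring.
      apply Rmult_le_compat_l; lra. }
    apply (Rmult_lt_compat_r (2 * m ^ 3)) in hN; [|exact p].
    replace (d ^ 2 / (2 * m ^ 3) * (2 * m ^ 3)) with (d ^ 2) in hN by (field; lra).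
    pose proof (norm_ge_0 v). nra. }
  assert (m2 : 0 < m ^ 2) by (apply pow_lt; lra).
  set (x := scal (/ m ^ 2) (G y)).
  assert (Tz : tends z x).
  { assert (T2 := tends_scal hip (/ m ^ 2) _ _ (tends_plus hip _ _ _ _ (tends_linear G _ _ hl hy)
       (tends_scal hip (-1) _ _ T))).
    intros d hd. destruct (T2 d hd) as [N hN]. exists N. intros n hn. specialize (hN n hn).
    rewrite (_ : minus (z n) x = minus (scal (/ m ^ 2)
         (plus (G (G (xs (phi n))))
            (scal (-1) (minus (G (G (z n))) (scal (m ^ 2) (z n))))))
         (scal (/ m ^ 2) (plus (G y) (scal (-1) zero)))); [exact hN | unfold x, z; vec hip; field; lra]. }
  assert (Vx : V x) by exact (tends_in_closed G V z x hV Vz Tz).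
  assert (Gx : G x = y).
  { apply (tends_unique hip (fun n => G (z n))); [|exact hy]. apply tends_linear; assumption. }
  assert (GGx : G (G x) = scal (m ^ 2) x).
  { rewrite Gx. unfold x. vec hip. field; lra. }
  clearbody x.
  assert (ny : norm y = m).
  { apply (tends_norm hip (fun n => G (z n))); [exact hy|].
    intros d hd. destruct (archimed_cor1 d hd) as [N [hN N0]]. exists N. intros n hn.
    assert (q : / INR (n + 1) <= / INR N).
    { apply Rinv_le_contravar; [apply lt_0_INR; lia | apply le_INR; lia]. }
    specialize (gz n). specialize (gz' n). apply Rabs_def1; lra. }
  assert (xn : x <> zero).
  { intros e. rewrite e (linear_zero G hl) in Gx. rewrite -Gx norm_zero in ny. lra. }
  (* [G^2 x = m^2 x], so [(G - m) (G + m) x = 0]. *)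
  destruct (classic (plus (G x) (scal m x) = zero)) as [w|w].
  - exists x, (- m). repeat split; auto.
    + rewrite Rabs_Ropp Rabs_pos_eq; lra.
    + rewrite (_ : G x = minus (plus (G x) (scal m x)) (scal m x)); [|vec hip].
      rewrite w. vec hip.
  - exists (plus (G x) (scal m x)), m. repeat split; auto.
    + apply (inv_plus _ _ hV); [apply (inv_map _ _ hV), Vx | apply (inv_scal _ _ hV), Vx].
    + rewrite Rabs_pos_eq; lra.
    + rewrite (linear_plus _ hl) (linear_scal _ hl) GGx. vec hip.
Qed.

Definition large_unit_eigenvector (eta : R) (e : H) : Prop :=
  norm e = 1 /\ exists lam : R, eta <= Rabs lam /\ G e = scal lam e.

Definition orthogonal_list (l : list H) : Prop := ForallOrdPairs (fun u v => ip u v = 0) l.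

(** Invariance comes from moving [G] onto the eigenvectors of the list by symmetry. *)
Lemma ortho_to_invariant eta l :
  List.Forall (large_unit_eigenvector eta) l -> invariant_subspace G (ortho_to l).
Proof.
  intros hl. split.
  - intros x y hx hy e he. rewrite (ip_plus_r hip) (hx e he) (hy e he). ring.
  - intros a x hx e he. rewrite (ip_scal_r hip) (hx e he). ring.
  - intros x hx e he. apply (ip_zero_closed hip). intros d hd.
    destruct (hx d hd) as [y [hy ny]]. exists y; split; [apply hy, he | exact ny].
  - intros x hx e he. rewrite -hsym.
    rewrite List.Forall_forall in hl. destruct (hl e he) as (_ & lam & _ & ->).
    rewrite (ip_scal hip) (hx e he). ring.
Qed.

(* Otherwise one could choose an infinite orthonormal sequence of eigenvectors with eigenvalues
   of modulus at least [eta], whose image has no convergent subsequence. *)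
Lemma compact_deflation (eta : R) : 0 < eta ->
  exists l, List.Forall (large_unit_eigenvector eta) l /\ orthogonal_list l /\
    forall x, ortho_to l x -> norm (G x) <= eta * norm x.
Proof.
  intros heta.
  apply NNPP. intros N.
  set (good := fun l => List.Forall (large_unit_eigenvector eta) l /\ orthogonal_list l).
  assert (X : forall l, exists e, good l -> large_unit_eigenvector eta e /\ ortho_to l e).
  { intros l. destruct (classic (good l)) as [g|g]; [|exists zero; tauto].
    destruct (classic (exists x, ortho_to l x /\ eta * norm x < norm (G x))) as [[x [ox hx]]|e].
    - destruct (compact_symmetric_eigenvector _ (ortho_to_invariant eta l (proj1 g)) eta x heta ox hx)
        as (e & lam & Ve & ne & le & Ge).
      assert (p : 0 < norm e).
      { pose proof (norm_ge_0 e). destruct (Req_dec (norm e) 0) as [z|z]; [|lra].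
        apply norm_zero_eq in z; tauto. }
      exists (scal (/ norm e) e). intros _. split; [split|].
      + rewrite (norm_scal_R hip) Rabs_pos_eq; [field; lra | left; apply Rinv_0_lt_compat, p].
      + exists lam. split; [exact le|]. rewrite (linear_scal _ (proj1 hG)) Ge. vec hip.
      + intros f hf. rewrite (ip_scal_r hip) (Ve f hf). ring.
    - exfalso. apply N. exists l. split; [apply g|split;[apply g|]].
      intros x ox. apply Rnot_lt_le. intros c. apply e. exists x; auto. }
  apply choice in X. destruct X as [f hf].
  (* A greedy construction: [ls n] holds the eigenvectors chosen in the first [n] steps, most recent
     first, and [u n] below is the one added next. *)
  set (ls := fix ls n := match n with O => nil | S n => f (ls n) :: ls n end).
  assert (gl : forall n, good (ls n)).
  { induction n as [|n IH]; [split; constructor|].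
    destruct (hf _ IH) as [h1 h2]. destruct IH as [I1 I2]. simpl. split; constructor; auto.
    apply Forall_forall. intros v hv. rewrite (ip_sym hip). apply h2, hv. }
  set (u := fun n => f (ls n)).
  assert (hu : forall n, large_unit_eigenvector eta (u n)) by (intros n; apply hf, gl).
  assert (hin : forall n k, In (u n) (ls (n + S k)%nat)).
  { intros n k. induction k as [|k IH].
    - rewrite Nat.add_1_r. left; reflexivity.
    - rewrite Nat.add_succ_r. right. exact IH. }
  assert (ho : forall n k, (n < k)%nat -> ip (u n) (u k) = 0).
  { intros n k hk. apply (proj2 (hf _ (gl k))).
    replace k with (n + S (k - n - 1))%nat by lia. apply hin. }
  destruct (proj2 hG u) as (phi & y & hphi & hy).
  { exists 1. intros n. right; apply hu. }
  apply tends_filterlim in hy.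
  destruct (hy (eta / 2)) as [K hK]; [lra|].
  pose proof (hK K (Nat.le_refl _)) as k1. pose proof (hK (S K) ltac:(lia)) as k2.
  pose proof (norm_minus_triangle hip (G (u (phi K))) y (G (u (phi (S K))))) as t.
  rewrite (norm_minus_sym hip y) in t.
  (* By orthonormality the squared distance is the sum of the two squared eigenvalues, each at least
     [eta ^ 2], while [k1], [k2] and [t] put the distance below [eta]. *)
  assert (q : norm (minus (G (u (phi K))) (G (u (phi (S K))))) ^ 2 >= eta ^ 2);
    [|pose proof (norm_ge_0 (minus (G (u (phi K))) (G (u (phi (S K)))))); nra].
  destruct (hu (phi K)) as (n1 & a & ha & ->). destruct (hu (phi (S K))) as (n2 & b & hb & ->).
  rewrite (norm_sq_minus hip) (ip_scal hip) (ip_scal_r hip) (ho _ _ (hphi K)).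
  rewrite !(norm_scal_R hip) n1 n2.
  pose proof (Rabs_pos b). nra.
Qed.

Definition lsum (l : list H) : H := fold_right plus zero l.

Lemma ip_lsum_zero w l : (forall e, In e l -> ip w e = 0) -> ip w (lsum l) = 0.
Proof.
  induction l as [|e l IH]; intros h; simpl; [apply (ip_zero_r hip)|].
  rewrite (ip_plus_r hip) IH; [|intros; apply h; right; assumption].
  rewrite (h e); [ring | left; reflexivity].
Qed.

Lemma lsum_linear (Phi : H -> H) l : is_linear Phi -> Phi (lsum l) = lsum (map Phi l).
Proof.
  intros hP. induction l as [|e l IH]; simpl; [apply linear_zero, hP|].
  rewrite (linear_plus _ hP) IH. reflexivity.
Qed.

Lemma orthonormal_remainder (l : list H) (x : H) :
  orthogonal_list l -> (forall e, In e l -> norm e = 1) ->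
  ortho_to l (minus x (lsum (map (fun e => scal (ip e x) e) l))).
Proof.
  intros o n. induction o as [|e l he o IH]; intros f hf; [destruct hf|].
  simpl. simpl in hf.
  rewrite (ip_minus_r hip) (ip_plus_r hip) (ip_scal_r hip).
  destruct hf as [<-|hf].
  - rewrite (ip_norm hip) n ?ip_lsum_zero; [ring | | left; reflexivity].
    intros g hg. apply in_map_iff in hg. destruct hg as (g' & <- & hg).
    rewrite (ip_scal_r hip). rewrite List.Forall_forall in he. rewrite (he g' hg). ring.
  - rewrite (ip_sym hip f e). rewrite List.Forall_forall in he. rewrite (he f hf).
    specialize (IH (fun g hg => n g (or_intror hg)) f hf).
    rewrite (ip_minus_r hip) in IH. rewrite Rmult_0_r Rplus_0_l. exact IH.
Qed.

Lemma orthogonal_map (Phi : H -> H) l :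
  (forall e, In e l -> exists a : R, Phi e = scal a e) -> orthogonal_list l -> orthogonal_list (map Phi l).
Proof.
  intros h o. induction o as [|e l he o IH]; simpl; constructor.
  - apply Forall_forall. intros g hg. apply in_map_iff in hg. destruct hg as (f & <- & hf).
    destruct (h e (or_introl eq_refl)) as [a ->]. destruct (h f (or_intror hf)) as [b ->].
    rewrite List.Forall_forall in he. rewrite (ip_scal hip) (ip_scal_r hip) (he f hf). ring.
  - apply IH. intros f hf. apply h. right; assumption.
Qed.

Lemma norm_sq_lsum_cons e l :
  orthogonal_list (e :: l) -> norm (lsum (e :: l)) ^ 2 = norm e ^ 2 + norm (lsum l) ^ 2.
Proof.
  intros o. inversion o as [|? ? he o']; subst. simpl lsum. rewrite (norm_sq_plus hip).
  rewrite ip_lsum_zero; [ring | intros f hf; rewrite List.Forall_forall in he; apply he, hf].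
Qed.
End CompactSymmetric.

(** * Functional calculus *)

Section FunctionalCalculus.
Context {H : NormedModule R_AbsRing} {ip : H -> H -> R} (hip : inner_product ip).
Context (A : operator H).

Definition eigenvector (nu : R) (e : H) : Prop := dom A e /\ A e = scal nu e.

Lemma fc_id : functional_calculus A (fun _ => 1) (fun u => u).
Proof. split; [apply is_linear_id|]. intros. vec hip. Qed.

Lemma fc_zero : functional_calculus A (fun _ => 0) (fun _ => zero).
Proof. split; [apply is_linear_zero|]. intros. vec hip. Qed.

Lemma fc_scal (c : R) f F :
  functional_calculus A f F -> functional_calculus A (fun x => c * f x) (fun u => scal c (F u)).
Proof.
  intros [l E]. split.
  - destruct (linear_norm _ l) as [C [hC B]]. split.
    + intros x y. rewrite (linear_plus _ l). vec hip.
    + intros k x. rewrite (linear_scal _ l). vec hip.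
    (* [is_linear] asks for a strictly positive bound, also when [c] is zero; hence the [+ 1]. *)
    + exists ((Rabs c + 1) * C). split; [pose proof (Rabs_pos c); nra|].
      intros x. rewrite (norm_scal_R hip). specialize (B x). pose proof (norm_ge_0 x).
      pose proof (Rabs_pos c). pose proof (norm_ge_0 (F x)). nra.
  - intros nu e d h. rewrite (E nu e d h). vec hip.
Qed.

Lemma fc_plus f F g G :
  functional_calculus A f F -> functional_calculus A g G ->
  functional_calculus A (fun x => f x + g x) (fun u => plus (F u) (G u)).
Proof.
  intros [l E] [l' E']. split.
  - destruct (linear_norm _ l) as [C [hC B]]. destruct (linear_norm _ l') as [C' [hC' B']]. split.
    + intros x y. rewrite (linear_plus _ l) (linear_plus _ l'). vec hip.
    + intros k x. rewrite (linear_scal _ l) (linear_scal _ l'). vec hip.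
    + exists (C + C'). split; [lra|].
      intros x. specialize (B x). specialize (B' x).
      eapply Rle_trans; [apply norm_triangle|]. lra.
  - intros nu e d h. rewrite (E nu e d h) (E' nu e d h). vec hip.
Qed.

Lemma fc_fun_ext f g F G :
  (forall x, f x = g x) -> (forall u, F u = G u) ->
  functional_calculus A f F -> functional_calculus A g G.
Proof.
  intros ef eF [l E]. split; [exact (is_linear_ext _ _ eF l)|].
  intros nu e d h. rewrite -ef -eF. apply E; assumption.
Qed.

Lemma fc_minus f F g G :
  functional_calculus A f F -> functional_calculus A g G ->
  functional_calculus A (fun x => f x - g x) (fun u => minus (F u) (G u)).
Proof.
  intros h h'. apply (fc_fun_ext (fun x => f x + (-1) * g x) _ (fun u => plus (F u) (scal (-1) (G u)))).
  - intros; ring.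
  - intros; vec hip.
  - apply fc_plus; [|apply fc_scal]; assumption.
Qed.

Lemma fc_compl f P :
  functional_calculus A f P -> functional_calculus A (fun x => 1 - f x) (compl P).
Proof. intros h. exact (fc_minus _ _ _ _ fc_id h). Qed.

Lemma fc_comp f F g G :
  functional_calculus A f F -> functional_calculus A g G ->
  functional_calculus A (fun x => f x * g x) (fun u => F (G u)).
Proof.
  intros [l E] [l' E']. split.
  - exact (is_linear_comp G F l' l).
  - intros nu e d h. rewrite (E' nu e d h) (linear_scal _ l) (E nu e d h). vec hip.
Qed.

(** * The resolvent, density of eigenvector sums, and the comparison principle *)

Context (hA : self_adjoint ip A).

Lemma symmetric u v : dom A u -> dom A v -> ip (A u) v = ip u (A v).
Proof. intros du dv. exact (proj2 (sa_adjoint hA v (A v)) (conj dv eq_refl) u du). Qed.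

Lemma dom_minus u v : dom A u -> dom A v -> dom A (minus u v).
Proof.
  intros du dv. rewrite (_ : minus u v = plus u (scal (-1) v)); [|vec hip].
  apply (dom_plus (sa_linear hA)); [|apply (dom_scal (sa_linear hA))]; assumption.
Qed.

Lemma op_minus u v : dom A u -> dom A v -> A (minus u v) = minus (A u) (A v).
Proof.
  intros du dv. rewrite (_ : minus u v = plus u (scal (-1) v)); [|vec hip].
  rewrite (op_plus (sa_linear hA)) ?(op_scal (sa_linear hA)) //; [vec hip|].
  apply (dom_scal (sa_linear hA)); assumption.
Qed.

Context (lam : R) (G : H -> H) (hG : resolvent_on A (fun _ => True) lam G) (hGc : compact_operator G).

Lemma resolvent_of (u : H) : dom A u -> G (minus (A u) (scal lam u)) = u.
Proof. intros d. exact (proj2 (res_left hG I d)). Qed.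

Lemma op_resolvent (y : H) : A (G y) = plus y (scal lam (G y)).
Proof.
  pose proof (res_right hG (u := y) I) as e. simpl in e. rewrite -{2}e. vec hip.
Qed.

Lemma resolvent_dom (y : H) : dom A (G y).
Proof. exact (proj2 (res_dom hG I)). Qed.

(** Apply symmetry of [A] to [G x] and [G y] and substitute [op_resolvent]; the terms carrying [lam]
    cancel. *)
Lemma resolvent_symmetric x y : ip (G x) y = ip x (G y).
Proof.
  pose proof (symmetric (G x) (G y) (resolvent_dom x) (resolvent_dom y)) as s.
  rewrite !op_resolvent (ip_plus hip) (ip_plus_r hip) (ip_scal hip) (ip_scal_r hip) in s. lra.
Qed.

(** A nonzero eigenvalue [a] of [G] puts [e] in the range of [G], hence in [dom A], and solving for
    [A e] gives the eigenvalue [lam + / a]. *)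
Lemma resolvent_large_eigenvector eta e :
  0 < eta -> large_unit_eigenvector G eta e -> exists nu, eigenvector nu e.
Proof.
  intros h (_ & a & ha & E).
  assert (na : a <> 0) by (intros ->; rewrite Rabs_R0 in ha; lra).
  exists (lam + / a).
  assert (e' : e = scal (/ a) (G e)) by (rewrite E; vec hip; field; assumption).
  split.
  - rewrite e'. apply (dom_scal (sa_linear hA)), resolvent_dom.
  - rewrite {1}e' (op_scal (sa_linear hA)); [|apply resolvent_dom].
    rewrite op_resolvent E. vec hip. field; assumption.
Qed.

(** The default value of the inverse at [x = lam] is harmless: [A - lam] is injective, so an
    eigenvector for [lam] is zero. *)
Lemma fc_resolvent : functional_calculus A (fun x => / (x - lam)) G.
Proof.
  split; [exact (proj1 hGc)|]. intros nu e d E.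
  pose proof (resolvent_of e d) as r.
  rewrite (_ : minus (A e) (scal lam e) = scal (nu - lam) e) in r; [|rewrite E; vec hip].
  rewrite (linear_scal _ (proj1 hGc)) in r.
  destruct (Req_dec nu lam) as [->|n].
  - assert (z : e = zero) by (rewrite -r; vec hip).
    rewrite z (linear_zero G (proj1 hGc)). vec hip.
  - rewrite -{2}r. vec hip. field. lra.
Qed.

Definition orthogonal_eigenvectors (l : list H) : Prop :=
  orthogonal_list (ip := ip) l /\ forall e, In e l -> exists nu, eigenvector nu e.

(** Deflate [G] at level [d] and project [y] onto the eigenvectors split off. [G] maps the
    projection to an orthogonal sum of eigenvectors; the remainder has norm at most [norm y], and
    [G] shrinks it by the factor [d], chosen so that [d * norm y < eta]. *)
Lemma eigen_sum_range (y : H) (eta : R) : 0 < eta ->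
  exists l, orthogonal_eigenvectors l /\ norm (minus (G y) (lsum l)) < eta.
Proof.
  intros h.
  set (d := eta / (norm y + 1)).
  assert (p : 0 < norm y + 1) by (pose proof (norm_ge_0 y); lra).
  assert (hd : 0 < d) by (apply Rdiv_lt_0_compat; lra).
  destruct (compact_deflation hip G hGc resolvent_symmetric d hd) as (l & hl & ol & B).
  rewrite List.Forall_forall in hl.
  assert (n1 : forall e, In e l -> norm e = 1) by (intros e he; apply (hl e he)).
  assert (ev : forall e, In e l -> exists nu, eigenvector nu e).
  { intros e he. exact (resolvent_large_eigenvector d e hd (hl e he)). }
  set (l1 := map (fun e => scal (ip e y) e) l).
  pose proof (orthonormal_remainder hip l y ol n1) as r. fold l1 in r.
  exists (map G l1). split; [split|].
  - unfold l1. rewrite map_map. apply (orthogonal_map hip); [|exact ol].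
    intros e he. destruct (ev e he) as [nu [de Ee]].
    rewrite (linear_scal _ (proj1 hGc)) (proj2 fc_resolvent nu e de Ee).
    exists (ip e y * / (nu - lam)). vec hip.
  - intros g hg. apply in_map_iff in hg. destruct hg as (f & <- & hf).
    apply in_map_iff in hf. destruct hf as (e & <- & he).
    destruct (ev e he) as [nu [de Ee]].
    rewrite (linear_scal _ (proj1 hGc)) (proj2 fc_resolvent nu e de Ee).
    exists nu. split.
    + do 2 apply (dom_scal (sa_linear hA)). exact de.
    + rewrite !(op_scal (sa_linear hA)) //; [|apply (dom_scal (sa_linear hA)), de]. rewrite Ee. vec hip.
  - rewrite -(lsum_linear _ _ (proj1 hGc)) -(linear_minus G _ _ (proj1 hGc)).
    apply Rle_lt_trans with (1 := B _ r).
    assert (c : norm (minus y (lsum l1)) <= norm y).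
    { assert (o : ip (lsum l1) (minus y (lsum l1)) = 0).
      { rewrite (ip_sym hip). apply (ip_lsum_zero hip). intros g hg. unfold l1 in hg.
        apply in_map_iff in hg. destruct hg as (e & <- & he).
        rewrite (ip_scal_r hip) (ip_sym hip _ e) (r e he). ring. }
      pose proof (norm_sq_plus hip (lsum l1) (minus y (lsum l1))) as s. rewrite o in s.
      rewrite (_ : plus (lsum l1) (minus y (lsum l1)) = y) in s; [|vec hip].
      pose proof (norm_ge_0 y). pose proof (norm_ge_0 (minus y (lsum l1))). nra. }
    apply Rle_lt_trans with (d * norm y); [apply Rmult_le_compat_l; lra|].
    unfold d. apply Rmult_lt_reg_r with (norm y + 1); [exact p|].
    replace (eta / (norm y + 1) * norm y * (norm y + 1)) with (eta * norm y) by (field; lra). nra.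
Qed.

(** Every vector of the dense set [dom A] is in the range of [G], to which the preceding lemma
    applies. *)
Lemma eigen_sum_dense (x : H) (eta : R) : 0 < eta ->
  exists l, orthogonal_eigenvectors l /\ norm (minus x (lsum l)) < eta.
Proof.
  intros h. destruct (sa_dense hA x (eta := eta / 2)) as (u & du & hu); [lra|].
  destruct (eigen_sum_range (minus (A u) (scal lam u)) (eta / 2)) as (l & ol & hl); [lra|].
  exists l. split; [exact ol|]. rewrite (resolvent_of u du) in hl.
  pose proof (norm_minus_triangle hip x u (lsum l)). lra.
Qed.

Lemma fc_orthogonal_eigenvectors f F l :
  functional_calculus A f F -> orthogonal_eigenvectors l -> orthogonal_list (ip := ip) (map F l).
Proof.
  intros hF [ol ev]. apply (orthogonal_map hip); [|exact ol].
  intros e he. destruct (ev e he) as [nu [de Ee]]. exists (f nu). apply (proj2 hF); assumption.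
Qed.

Lemma fc_compare_sum f F g G' l :
  functional_calculus A f F -> functional_calculus A g G' ->
  (forall nu e, eigenvector nu e -> e <> zero -> Rabs (f nu) <= Rabs (g nu)) ->
  orthogonal_eigenvectors l -> norm (F (lsum l)) <= norm (G' (lsum l)).
Proof.
  intros hF hG' le ol. apply Rsqr_incr_0_var; [|apply norm_ge_0].
  rewrite !Rsqr_pow2 (lsum_linear _ _ (proj1 hF)) (lsum_linear _ _ (proj1 hG')).
  pose proof (fc_orthogonal_eigenvectors f F l hF ol) as o1.
  pose proof (fc_orthogonal_eigenvectors g G' l hG' ol) as o2.
  destruct ol as [_ ev].
  induction l as [|e l IH]; [simpl; lra|].
  simpl map in o1, o2 |- *. rewrite !(norm_sq_lsum_cons hip) //.
  inversion o1; inversion o2; subst.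
  apply Rplus_le_compat; [|apply IH; auto; intros; apply ev; right; assumption].
  destruct (ev e (or_introl eq_refl)) as [nu he].
  rewrite (proj2 hF nu e (proj1 he) (proj2 he)) (proj2 hG' nu e (proj1 he) (proj2 he)).
  rewrite !(norm_scal_R hip). apply pow_incr. split.
  - apply Rmult_le_pos; [apply Rabs_pos | apply norm_ge_0].
  - destruct (classic (e = zero)) as [->|n].
    + rewrite norm_zero. lra.
    + apply Rmult_le_compat_r; [apply norm_ge_0 | exact (le nu e he n)].
Qed.

Lemma fc_compare f F g G' x :
  functional_calculus A f F -> functional_calculus A g G' ->
  (forall nu e, eigenvector nu e -> e <> zero -> Rabs (f nu) <= Rabs (g nu)) ->
  norm (F x) <= norm (G' x).
Proof.
  intros hF hG' le. apply Rnot_lt_le. intros lt.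
  destruct (linear_norm _ (proj1 hF)) as [C [hC B]].
  destruct (linear_norm _ (proj1 hG')) as [C' [hC' B']].
  (* Replacing [x] by the sum changes the two norms by at most [C] and [C'] times the distance; this
     radius makes the total change smaller than the supposed gap. *)
  destruct (eigen_sum_dense x ((norm (F x) - norm (G' x)) / (C + C'))) as (l & ol & hl).
  { apply Rdiv_lt_0_compat; lra. }
  pose proof (fc_compare_sum f F g G' l hF hG' le ol) as c.
  pose proof (norm_le_minus hip (F x) (F (lsum l))) as t1.
  pose proof (norm_le_minus hip (G' (lsum l)) (G' x)) as t2.
  rewrite (norm_minus_sym hip (G' (lsum l))) in t2.
  rewrite -(linear_minus _ _ _ (proj1 hF)) in t1. rewrite -(linear_minus _ _ _ (proj1 hG')) in t2.
  specialize (B (minus x (lsum l))). specialize (B' (minus x (lsum l))).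
  apply (Rmult_lt_compat_l (C + C')) in hl; [|lra].
  replace ((C + C') * ((norm (F x) - norm (G' x)) / (C + C'))) with (norm (F x) - norm (G' x)) in hl
    by (field; lra).
  lra.
Qed.

(** Compare the difference, which is the calculus of [f - g], with the zero operator. *)
Lemma fc_unique f F g G' x :
  functional_calculus A f F -> functional_calculus A g G' ->
  (forall nu e, eigenvector nu e -> e <> zero -> f nu = g nu) -> F x = G' x.
Proof.
  intros hF hG' E.
  assert (z : norm (minus (F x) (G' x)) <= norm (zero : H)).
  { apply (fc_compare _ _ _ _ x (fc_minus _ _ _ _ hF hG') fc_zero).
    intros nu e he n. rewrite (E nu e he n) Rminus_diag. lra. }
  rewrite norm_zero in z.
  assert (z' : minus (F x) (G' x) = zero).
  { apply norm_zero_eq, Rle_antisym; [exact z | apply norm_ge_0]. }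
  rewrite (_ : F x = plus (minus (F x) (G' x)) (G' x)); [|vec hip]. rewrite z'. apply plus_zero_l.
Qed.

Context (hA0 : nonnegative ip A).

Lemma eigenvalue_nonneg nu e : eigenvector nu e -> e <> zero -> 0 <= nu.
Proof.
  intros [d E] n. pose proof (hA0 e d) as p. rewrite E (ip_scal hip) (ip_norm hip) in p.
  assert (q : 0 < norm e).
  { pose proof (norm_ge_0 e). destruct (Req_dec (norm e) 0) as [z|z]; [|lra].
    apply norm_zero_eq in z; tauto. }
  assert (0 < norm e ^ 2) by (apply pow_lt, q). nra.
Qed.
End FunctionalCalculus.

(** * Spectral projections *)

(** Completeness as a property, so that the sections below can work over a [NormedModule], the
    structure on which inner products and operators are stated. *)
Definition complete_norm (H : NormedModule R_AbsRing) : Prop :=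
  forall u : nat -> H,
    (forall eta, 0 < eta ->
       exists N, forall n m, (N <= n)%nat -> (N <= m)%nat -> norm (minus (u n) (u m)) < eta) ->
    exists l, tends u l.

Lemma complete_normed_module (H : CompleteNormedModule R_AbsRing) : complete_norm H.
Proof.
  intros u C.
  destruct (proj1 (filterlim_locally_cauchy (F := eventually) u)) as [l hl].
  - intros eta. destruct (C eta (cond_pos eta)) as [N hN].
    exists (fun n => (N <= n)%nat). split; [exists N; auto|].
    intros n m hn hm. apply (norm_compat1 (V := H)). apply hN; assumption.
  - exists l. apply tends_filterlim. exact hl.
Qed.

(** [sum_n] up to [length l] has one term more than the list; it is the default value [zero] of
    [nth]. This also covers the empty list. *)
Lemma lsum_sum_n {H : NormedModule R_AbsRing} (l : list H) :
  lsum l = sum_n (fun k => nth k l zero) (length l).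
Proof.
  induction l as [|e l IH]; simpl.
  - rewrite sum_O. reflexivity.
  - rewrite /sum_n sum_Sn_m; [|lia]. rewrite -sum_n_m_S. simpl. f_equal. exact IH.
Qed.

Lemma indicator_nonneg (N x : R) : 0 <= x ->
  (x <= N /\ indicator 0 N x = 1) \/ (N < x /\ indicator 0 N x = 0).
Proof. intros h. unfold indicator. destruct (Rle_dec 0 x), (Rle_dec x N); lra. Qed.

Section SpectralProjection.
Context {H : NormedModule R_AbsRing} {ip : H -> H -> R} (hip : inner_product ip).
Context (A : operator H) (hA : self_adjoint ip A) (hA0 : nonnegative ip A) (hAc : compact_resolvent A).

Lemma fc_le f F g G x :
  functional_calculus A f F -> functional_calculus A g G ->
  (forall nu, 0 <= nu -> Rabs (f nu) <= Rabs (g nu)) -> norm (F x) <= norm (G x).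
Proof.
  intros hF hG le. destruct hAc as (lam & R & hR & cR).
  apply (fc_compare hip A hA lam R hR cR f F g G x hF hG).
  intros nu e he n. apply le. exact (eigenvalue_nonneg hip A hA0 nu e he n).
Qed.

Lemma fc_eq f F g G x :
  functional_calculus A f F -> functional_calculus A g G ->
  (forall nu, 0 <= nu -> f nu = g nu) -> F x = G x.
Proof.
  intros hF hG le. destruct hAc as (lam & R & hR & cR).
  apply (fc_unique hip A hA lam R hR cR f F g G x hF hG).
  intros nu e he n. apply le. exact (eigenvalue_nonneg hip A hA0 nu e he n).
Qed.

Context (P : H -> H) (N : R) (hP : functional_calculus A (indicator 0 N) P).

Lemma op_zero : A zero = zero.
Proof.
  rewrite (_ : A zero = scal 0 (A zero)); [|rewrite -(op_scal (sa_linear hA) 0 (dom_zero (sa_linear hA)))].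
  - vec hip.
  - f_equal. vec hip.
Qed.

Let hQ := fc_compl hip A _ _ hP.

Lemma proj_idem x : P (P x) = P x.
Proof.
  apply (fc_eq _ _ _ _ x (fc_comp hip A _ _ _ _ hP hP) hP). intros nu h.
  destruct (indicator_nonneg N nu h) as [[_ ->]|[_ ->]]; ring.
Qed.

Lemma proj_compl x : P (compl P x) = zero.
Proof.
  apply (fc_eq _ _ _ _ x (fc_comp hip A _ _ _ _ hP hQ) (fc_zero hip A)). intros nu h.
  destruct (indicator_nonneg N nu h) as [[_ ->]|[_ ->]]; ring.
Qed.

Lemma compl_of_proj_zero x : P x = zero -> compl P x = x.
Proof. intros z. unfold compl. rewrite z. vec hip. Qed.

Lemma range_proj x : range P x <-> P x = x.
Proof. split; [intros [w ->]; apply proj_idem | intros e; exists x; auto]. Qed.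

Lemma range_compl x : range (compl P) x <-> P x = zero.
Proof.
  split; [intros [w ->]; apply proj_compl | intros e; exists x].
  symmetry. exact (compl_of_proj_zero x e).
Qed.

Lemma norm_proj_le x : norm (P x) <= norm x.
Proof.
  apply (fc_le _ _ _ _ x hP (fc_id hip A)). intros nu h.
  destruct (indicator_nonneg N nu h) as [[_ ->]|[_ ->]]; rewrite ?Rabs_R0 ?Rabs_R1; lra.
Qed.

Lemma norm_compl_le x : norm (compl P x) <= norm x.
Proof.
  apply (fc_le _ _ _ _ x hQ (fc_id hip A)). intros nu h.
  destruct (indicator_nonneg N nu h) as [[_ ->]|[_ ->]];
    rewrite ?Rminus_0_r ?Rminus_diag ?Rabs_R0 ?Rabs_R1; lra.
Qed.

(* The reflection [P - Q] is isometric, so [p + q] and [p - q] have the same norm. *)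
Lemma ip_proj_compl x : ip (P x) (compl P x) = 0.
Proof.
  assert (e : norm (minus (P x) (compl P x)) = norm x).
  { apply Rle_antisym.
    - apply (fc_le _ _ _ _ x (fc_minus hip A _ _ _ _ hP hQ) (fc_id hip A)). intros nu h.
      destruct (indicator_nonneg N nu h) as [[_ ->]|[_ ->]]; unfold Rabs; repeat destruct Rcase_abs; lra.
    - apply (fc_le _ _ _ _ x (fc_id hip A) (fc_minus hip A _ _ _ _ hP hQ)). intros nu h.
      destruct (indicator_nonneg N nu h) as [[_ ->]|[_ ->]]; unfold Rabs; repeat destruct Rcase_abs; lra. }
  pose proof (norm_sq_minus hip (P x) (compl P x)) as m. rewrite e in m.
  pose proof (norm_sq_plus hip (P x) (compl P x)) as p.
  rewrite (_ : plus (P x) (compl P x) = x) in p; [|unfold compl; vec hip]. lra.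
Qed.

Lemma norm_sq_proj_compl p q : P p = p -> P q = zero -> norm (plus p q) ^ 2 = norm p ^ 2 + norm q ^ 2.
Proof.
  intros hp hq. pose proof (ip_proj_compl (plus p q)) as o.
  rewrite /compl (linear_plus _ (proj1 hP)) hp hq in o.
  rewrite (_ : plus p zero = p) in o; [|vec hip].
  rewrite (_ : minus (plus p q) p = q) in o; [|vec hip].
  rewrite (norm_sq_plus hip) o. ring.
Qed.

(** [P] commutes with the bounded operator [G] by uniqueness of the calculus. Writing [u] as a value
    of [G] therefore exhibits [P u] as one too. *)
Lemma proj_op u : dom A u -> dom A (P u) /\ A (P u) = P (A u).
Proof.
  intros du. destruct hAc as (lam & G & hG & cG).
  assert (e : P u = G (P (minus (A u) (scal lam u)))).
  { rewrite -{1}(resolvent_of A lam G hG u du).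
    assert (hR := fc_resolvent hip A lam G hG cG).
    apply (fc_eq _ _ _ _ _ (fc_comp hip A _ _ _ _ hP hR) (fc_comp hip A _ _ _ _ hR hP)). intros; ring. }
  split; rewrite e; [exact (resolvent_dom A lam G hG _)|].
  rewrite (op_resolvent hip A lam G hG) -e (linear_minus _ _ _ (proj1 hP)) (linear_scal _ (proj1 hP)).
  vec hip.
Qed.

(** Comparison concerns bounded operators only, so the claim is rewritten through [y], with
    [u = G y] and [(A - nu) u = y + (lam - nu) G y]. On an eigenvalue [k > N] it reduces to
    [N - nu <= k - nu] after division by the modulus of [k - lam]. *)
Lemma compl_coercive nu u : nu < N -> dom A u -> P u = zero ->
  (N - nu) * norm u <= norm (minus (A u) (scal nu u)).
Proof.
  intros hnu du hu. destruct hAc as (lam & G & hG & cG).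
  set (y := minus (A u) (scal lam u)).
  assert (ey : G y = u) by exact (resolvent_of A lam G hG u du).
  assert (hR := fc_resolvent hip A lam G hG cG).
  assert (c : norm (scal (N - nu) (compl P (G y))) <=
              norm (plus (compl P y) (scal (lam - nu) (compl P (G y))))).
  { assert (hQR := fc_comp hip A _ _ _ _ hQ hR).
    apply (fc_compare hip A hA lam G hG cG _ _ _ _ y (fc_scal hip A (N - nu) _ _ hQR)
      (fc_plus hip A _ _ _ _ hQ (fc_scal hip A (lam - nu) _ _ hQR))).
    intros k e he n. pose proof (eigenvalue_nonneg hip A hA0 k e he n) as h.
    destruct (Req_dec k lam) as [->|hk].
    { exfalso. apply n. rewrite -(resolvent_of A lam G hG e (proj1 he)) (proj2 he).
      rewrite (_ : minus (scal lam e) (scal lam e) = zero); [|vec hip].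
      exact (linear_zero G (proj1 cG)). }
    destruct (indicator_nonneg N k h) as [[_ ->]|[hk' ->]].
    - right; f_equal; ring.
    - rewrite Rminus_0_r !Rmult_1_l.
      replace (1 + (lam - nu) * / (k - lam)) with ((k - nu) * / (k - lam)) by (field; lra).
      rewrite !Rabs_mult. apply Rmult_le_compat_r; [apply Rabs_pos|].
      rewrite !Rabs_pos_eq; lra. }
  rewrite ey (compl_of_proj_zero u hu) (norm_scal_R hip) Rabs_pos_eq in c; [|lra].
  apply Rle_trans with (1 := c).
  apply Rle_trans with (2 := norm_compl_le (minus (A u) (scal nu u))). right; f_equal.
  rewrite /y /compl !(linear_minus _ _ _ (proj1 hP)) !(linear_scal _ (proj1 hP)) hu. vec hip.
Qed.

(** If [k <= N] the right side vanishes and [u] is zero; otherwise [u] is [e] divided by [k - nu],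
    which is positive. *)
Lemma compl_equation_eigenvector nu e k : nu < N -> eigenvector A k e ->
  exists u, dom A u /\ P u = zero /\ minus (A u) (scal nu u) = compl P e.
Proof.
  intros hnu he.
  assert (Pe : P e = scal (indicator 0 N k) e) by (apply (proj2 hP); apply he).
  destruct (classic (e = zero)) as [->|n].
  { exists zero. split; [apply (dom_zero (sa_linear hA))|split].
    - exact (linear_zero P (proj1 hP)).
    - rewrite /compl (linear_zero P (proj1 hP)). rewrite op_zero. vec hip. }
  destruct (indicator_nonneg N k (eigenvalue_nonneg hip A hA0 k e he n)) as [[_ E]|[hk E]]; rewrite E in Pe.
  - exists zero. split; [apply (dom_zero (sa_linear hA))|split].
    + exact (linear_zero P (proj1 hP)).
    + rewrite /compl Pe. rewrite op_zero. vec hip.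
  - exists (scal (/ (k - nu)) e). split; [apply (dom_scal (sa_linear hA)), he|split].
    + rewrite (linear_scal _ (proj1 hP)) Pe. vec hip.
    + rewrite /compl (op_scal (sa_linear hA)) ?(proj2 he) ?Pe; [|apply he]. vec hip. field. lra.
Qed.

Lemma compl_equation_sum nu l : nu < N -> (forall e, In e l -> exists k, eigenvector A k e) ->
  exists u, dom A u /\ P u = zero /\ minus (A u) (scal nu u) = compl P (lsum l).
Proof.
  intros hnu. induction l as [|e l IH]; intros ev.
  - apply (compl_equation_eigenvector nu zero 0 hnu).
    split; [apply (dom_zero (sa_linear hA))|]. rewrite op_zero. vec hip.
  - destruct (IH (fun f hf => ev f (or_intror hf))) as (u & du & Pu & Eu).
    destruct (ev e (or_introl eq_refl)) as [k he].
    destruct (compl_equation_eigenvector nu e k hnu he) as (v & dv & Pv & Ev).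
    exists (plus v u). split; [apply (dom_plus (sa_linear hA)); assumption|split].
    + rewrite (linear_plus _ (proj1 hP)) Pu Pv. vec hip.
    + rewrite (op_plus (sa_linear hA)) //. simpl lsum.
      rewrite (_ : compl P (plus e (lsum l)) = plus (compl P e) (compl P (lsum l))).
      * rewrite -Ev -Eu. vec hip.
      * exact (linear_plus _ (proj1 hQ) e (lsum l)).
Qed.

(** * Solvability and spectrum of [A] on the range of [compl P] *)

Context (hcomplete : complete_norm H).

(* On [Q H] the operator [A - nu] is bounded below with dense range; its range is closed because
   [A] is a closed operator. *)
Lemma compl_equation nu x : nu < N -> P x = zero ->
  exists u, dom A u /\ P u = zero /\ minus (A u) (scal nu u) = x.
Proof.
  intros hnu hx.
  assert (X : forall n : nat, exists u, dom A u /\ P u = zero /\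
      norm (minus x (minus (A u) (scal nu u))) < / INR (n + 1)).
  { intros n. destruct hAc as (lam & G & hG & cG).
    assert (p : 0 < / INR (n + 1)) by (apply Rinv_0_lt_compat, lt_0_INR; lia).
    destruct (eigen_sum_dense hip A hA lam G hG cG x _ p) as (l & [_ ev] & hl).
    destruct (compl_equation_sum nu l hnu ev) as (u & du & Pu & Eu).
    exists u. split; [exact du|split;[exact Pu|]].
    rewrite Eu. apply Rle_lt_trans with (2 := hl).
    rewrite -{1}(compl_of_proj_zero x hx).
    rewrite -(linear_minus _ _ _ (proj1 hQ)). apply norm_compl_le. }
  apply choice in X. destruct X as [u hu].
  set (r := fun n => minus (A (u n)) (scal nu (u n))).
  assert (Tr : tends r x).
  { intros d hd. destruct (archimed_cor1 d hd) as [K [hK K0]]. exists K. intros n hn.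
    rewrite (norm_minus_sym hip). apply Rlt_trans with (1 := proj2 (proj2 (hu n))).
    apply Rle_lt_trans with (2 := hK).
    apply Rinv_le_contravar; [apply lt_0_INR; lia | apply le_INR; lia]. }
  destruct (hcomplete u) as [v hv].
  { intros d hd. destruct (Tr ((N - nu) * d / 2)) as [K hK].
    { assert (0 < (N - nu) * d) by (apply Rmult_lt_0_compat; lra). lra. }
    exists K. intros n m hn hm.
    pose proof (hK n hn) as t1. pose proof (hK m hm) as t2.
    pose proof (norm_minus_triangle hip (r n) x (r m)) as t3.
    rewrite (norm_minus_sym hip x) in t3.
    destruct (hu n) as (d1 & p1 & _). destruct (hu m) as (d2 & p2 & _).
    assert (c : (N - nu) * norm (minus (u n) (u m)) <= norm (minus (r n) (r m))).
    { rewrite (_ : minus (r n) (r m) = minus (A (minus (u n) (u m))) (scal nu (minus (u n) (u m)))).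
      - apply compl_coercive; [exact hnu | apply (dom_minus hip A hA); assumption|].
        rewrite (linear_minus _ _ _ (proj1 hP)) p1 p2. vec hip.
      - rewrite (op_minus hip A hA) // /r. vec hip. }
    apply Rmult_lt_reg_l with (N - nu); lra. }
  destruct hAc as (lam & G & hG & cG).
  (* Closedness of [A] enters through the continuity of [G]: each [u n] is [G] of
     [r n + (nu - lam) u n], and the limit of this relation puts [v] in [dom A]. *)
  assert (ev : v = G (plus x (scal (nu - lam) v))).
  { apply (tends_unique hip u); [exact hv|].
    intros d hd.
    destruct (tends_linear G _ _ (proj1 cG) (tends_plus hip _ _ _ _ Tr (tends_scal hip (nu - lam) _ _ hv)) d hd)
      as [K hK].
    exists K. intros n hn. specialize (hK n hn).
    rewrite -{1}(resolvent_of A lam G hG (u n) (proj1 (hu n))).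
    rewrite (_ : minus (A (u n)) (scal lam (u n)) = plus (r n) (scal (nu - lam) (u n))); [exact hK|].
    unfold r. vec hip. }
  exists v. split; [rewrite ev; exact (resolvent_dom A lam G hG _)|split].
  - apply (tends_unique hip (fun n => P (u n))); [apply tends_linear; [apply hP | exact hv]|].
    intros d hd. exists O. intros n _. rewrite (proj1 (proj2 (hu n))).
    rewrite (_ : minus zero zero = zero); [rewrite norm_zero; exact hd | vec hip].
  - rewrite {1}ev (op_resolvent hip A lam G hG) -ev. vec hip.
Qed.

(** Below [N], choosing solutions of the preceding equation defines a resolvent. Coercivity provides
    both uniqueness, needed for the left inverse, and the bound [/ (N - nu)]. *)
Lemma spectrum_compl_ge nu : spectrum_on A (range (compl P)) nu -> N <= nu.
Proof.
  intros s. apply Rnot_lt_le. intros hnu. apply s. clear s.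
  assert (X : forall x, exists u, P x = zero ->
      dom A u /\ P u = zero /\ minus (A u) (scal nu u) = x).
  { intros x. destruct (classic (P x = zero)) as [h|h]; [|exists zero; tauto].
    destruct (compl_equation nu x hnu h) as [u hu]. exists u; auto. }
  apply choice in X. destruct X as [R hR]. exists R. split.
  - intros u hu. apply range_compl in hu. rewrite range_compl. split; apply hR, hu.
  - intros u hu. apply range_compl in hu. apply hR, hu.
  - intros u hu du. apply range_compl in hu.
    assert (h : P (minus (A u) (scal nu u)) = zero).
    { rewrite (linear_minus _ _ _ (proj1 hP)) -(proj2 (proj_op u du)) (linear_scal _ (proj1 hP)) hu.
      rewrite op_zero. vec hip. }
    split; [apply range_compl, h|].
    destruct (hR _ h) as (d & p & E).
    set (v := R (minus (A u) (scal nu u))) in *.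
    assert (c : (N - nu) * norm (minus v u) <= norm (minus (A (minus v u)) (scal nu (minus v u)))).
    { apply compl_coercive; [exact hnu | apply (dom_minus hip A hA); assumption|].
      rewrite (linear_minus _ _ _ (proj1 hP)) p hu. vec hip. }
    rewrite (op_minus hip A hA) // in c.
    rewrite (_ : minus (minus (A v) (A u)) (scal nu (minus v u)) =
      minus (minus (A v) (scal nu v)) (minus (A u) (scal nu u))) in c; [|vec hip].
    rewrite E in c.
    rewrite (_ : minus (minus (A u) (scal nu u)) (minus (A u) (scal nu u)) = zero) in c; [|vec hip].
    rewrite norm_zero in c.
    assert (z : minus v u = zero).
    { apply norm_zero_eq. pose proof (norm_ge_0 (minus v u)). nra. }
    rewrite (_ : v = plus (minus v u) u); [|vec hip]. rewrite z. apply plus_zero_l.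
  - exists (/ (N - nu)). intros u hu. apply range_compl in hu. destruct (hR u hu) as (d & p & E).
    pose proof (compl_coercive nu (R u) hnu d p) as c. rewrite E in c.
    apply Rmult_le_reg_l with (N - nu); [lra|].
    rewrite -Rmult_assoc Rinv_r ?Rmult_1_l; lra.
Qed.

(** A resolvent [G] at [nu] would send [(A - nu) e = zero] back to [e], while its norm bound forces
    [G zero = zero]. *)
Lemma spectrum_compl_eigenvalue nu e :
  N < nu -> 0 <= nu -> eigenvector A nu e -> e <> zero -> spectrum_on A (range (compl P)) nu.
Proof.
  intros h h0 [d E] n [G hG]. apply n.
  assert (Pe : P e = zero).
  { rewrite (proj2 hP nu e d E). destruct (indicator_nonneg N nu h0) as [[? _]|[_ ->]]; [lra|vec hip]. }
  destruct (res_left hG (proj2 (range_compl e) Pe) d) as [r l].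
  rewrite (_ : minus (A e) (scal nu e) = zero) in l; [|rewrite E; vec hip].
  rewrite (_ : minus (A e) (scal nu e) = zero) in r; [|rewrite E; vec hip].
  destruct (res_bound hG) as [C hC]. specialize (hC zero r). rewrite l norm_zero Rmult_0_r in hC.
  apply norm_zero_eq, Rle_antisym; [exact hC | apply norm_ge_0].
Qed.

Context (hdim : infinite_dimensional H).

(* If all eigenvalues were at most [N], then the resolvent would be bounded below; a finite rank
   perturbation of it is small, so its finitely many eigenvectors would span [H]. *)
Lemma exists_large_eigenvalue : exists nu e, N < nu /\ eigenvector A nu e /\ e <> zero.
Proof.
  apply NNPP. intros X.
  assert (small : forall nu e, eigenvector A nu e -> e <> zero -> 0 <= nu <= N).
  { intros nu e he n. split; [exact (eigenvalue_nonneg hip A hA0 nu e he n)|].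
    apply Rnot_lt_le. intros lt. apply X. exists nu, e; auto. }
  destruct hAc as (lam & G & hG & cG).
  assert (hR := fc_resolvent hip A lam G hG cG).
  (* [K] exceeds the distance from [lam] to every eigenvalue in the interval from 0 to [N], so [K]
     times the inverse of that distance is at least 1. *)
  set (K := Rabs N + Rabs lam + 1).
  assert (K0 : 0 < K) by (unfold K; pose proof (Rabs_pos N); pose proof (Rabs_pos lam); lra).
  assert (below : forall x, norm x <= K * norm (G x)).
  { intros x. rewrite -{1}(Rabs_pos_eq K); [|lra]. rewrite -(norm_scal_R hip).
    apply (fc_compare hip A hA lam G hG cG _ _ _ _ x (fc_id hip A) (fc_scal hip A K _ _ hR)).
    intros nu e he n. specialize (small nu e he n).
    assert (nl : nu <> lam).
    { intros ->. apply n. rewrite -(resolvent_of A lam G hG e (proj1 he)) (proj2 he).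
      rewrite (_ : minus (scal lam e) (scal lam e) = zero); [|vec hip].
      exact (linear_zero G (proj1 cG)). }
    rewrite Rabs_R1 Rabs_mult Rabs_inv (Rabs_pos_eq K); [|lra].
    assert (p : 0 < Rabs (nu - lam)) by (apply Rabs_pos_lt; lra).
    apply Rmult_le_reg_r with (Rabs (nu - lam)); [exact p|].
    rewrite Rmult_assoc Rinv_l; [|lra]. rewrite Rmult_1_l Rmult_1_r.
    unfold K, Rabs; repeat destruct Rcase_abs; lra. }
  (* At this level [K * norm (G z) <= norm z / 2] on the orthogonal complement of [l]; together with
     [below] this leaves only [z = zero] there. *)
  destruct (compact_deflation hip G cG (resolvent_symmetric hip A hA lam G hG) (/ (2 * K)))
    as (l & hl & ol & B); [apply Rinv_0_lt_compat; lra|].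
  rewrite List.Forall_forall in hl.
  apply hdim. exists (length l), (fun k => nth k l zero). intros x.
  exists (fun k => ip (nth k l zero) x).
  pose proof (orthonormal_remainder hip l x ol (fun e he => proj1 (hl e he))) as o.
  set (s := lsum (map (fun e => scal (ip e x) e) l)) in o.
  assert (z : minus x s = zero).
  { apply norm_zero_eq. specialize (B _ o). specialize (below (minus x s)).
    pose proof (norm_ge_0 (minus x s)).
    apply (Rmult_le_compat_l K) in B; [|lra].
    replace (K * (/ (2 * K) * norm (minus x s))) with (norm (minus x s) / 2) in B by (field; lra). lra. }
  transitivity s.
  - rewrite (_ : x = plus (minus x s) s); [|vec hip]. rewrite z. apply plus_zero_l.
  - unfold s. rewrite lsum_sum_n length_map. apply sum_n_ext. intros k.
    rewrite -(map_nth (fun e => scal (ip e x) e) l zero k). f_equal.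
    vec hip.
Qed.

(** [lambda_plus] is the [real] part of an extended infimum, which would default to 0 at infinity.
    It is finite because [N] bounds the spectrum below and infinite dimension supplies an eigenvalue
    above [N]. *)
Lemma lambda_plus_bounds :
  N <= lambda_plus A P /\
  forall nu e, N < nu -> eigenvector A nu e -> e <> zero -> lambda_plus A P <= nu.
Proof.
  unfold lambda_plus. pose proof (Glb_Rbar_correct (spectrum_on A (range (compl P)))) as [lb gl].
  assert (low : Rbar_le N (Glb_Rbar (spectrum_on A (range (compl P))))).
  { apply gl. intros x hx. simpl. exact (spectrum_compl_ge x hx). }
  assert (up : forall nu e, N < nu -> eigenvector A nu e -> e <> zero ->
     Rbar_le (Glb_Rbar (spectrum_on A (range (compl P)))) nu).
  { intros nu e h he n. apply lb.
    exact (spectrum_compl_eigenvalue nu e h (eigenvalue_nonneg hip A hA0 nu e he n) he n). }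
  destruct exists_large_eigenvalue as (nu0 & e0 & h0 & he0 & n0).
  pose proof (up nu0 e0 h0 he0 n0) as u0.
  destruct (Glb_Rbar (spectrum_on A (range (compl P)))) as [g| |]; simpl in *; try tauto.
Qed.
End SpectralProjection.

(** * Error estimate *)

(** The solution of [U' = L * (U + exp (- lam * t) * q + d)] with [U 0 = 0]. *)
Definition gronwall_bound (L lam q d t : R) : R :=
  L * (exp (L * t) - exp (- lam * t)) / (L + lam) * q + (exp (L * t) - 1) * d.

Lemma exp_le (x y : R) : x <= y -> exp x <= exp y.
Proof. intros [h| ->]; [left; apply exp_increasing, h | right; reflexivity]. Qed.

Lemma gronwall_bound_mono L lam q d s t :
  0 < L -> 0 < lam -> 0 <= q -> 0 <= d -> s <= t -> gronwall_bound L lam q d s <= gronwall_bound L lam q d t.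
Proof.
  intros hL hl hq hd h. unfold gronwall_bound.
  assert (e1 : exp (L * s) <= exp (L * t)) by (apply exp_le; nra).
  assert (e2 : exp (- lam * t) <= exp (- lam * s)) by (apply exp_le; nra).
  apply Rplus_le_compat; apply Rmult_le_compat_r; try lra.
  unfold Rdiv. apply Rmult_le_compat_r; [left; apply Rinv_0_lt_compat; lra|].
  apply Rmult_le_compat_l; lra.
Qed.

(** Let [U] be the integral on the right. The weighted difference [W] of [U] and the bound vanishes
    at 0 and has derivative [L * exp (- L * s) * (phi s - U s)], which is nonpositive for [s >= 0]
    by hypothesis; hence [phi t <= U t], and [U t] is below the bound. *)
Lemma gronwall (phi : R -> R) (L lam q d : R) :
  0 < L -> 0 < lam -> (forall s, continuous phi s) ->
  (forall t, 0 <= t -> phi t <= RInt (fun s => L * (phi s + (exp (- lam * s) * q + d))) 0 t) ->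
  forall t, 0 <= t -> phi t <= gronwall_bound L lam q d t.
Proof.
  intros hL hl hc hi t ht.
  set (g := fun s => L * (phi s + (exp (- lam * s) * q + d))) in *.
  assert (gc : forall s, continuous g s).
  { intros s. apply (continuous_mult (fun _ => L)); [apply continuous_const|].
    apply (continuous_plus phi); [apply hc|].
    apply (ex_derive_continuous (fun s => exp (- lam * s) * q + d)). auto_derive; auto. }
  assert (dU : forall s, is_derive (RInt g 0) s (g s)).
  { intros s. apply (is_derive_RInt g (RInt g 0) 0); [|apply gc].
    apply filter_forall. intros b. apply (RInt_correct (V := R_CompleteNormedModule)).
    apply (ex_RInt_continuous (V := R_CompleteNormedModule)). intros; apply gc. }
  assert (U0 : RInt g 0 0 = 0) by exact (RInt_point (V := R_CompleteNormedModule) 0 g).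
  revert hi dU U0. generalize (RInt g 0). intros U hi dU U0.
  set (W := fun s => exp (- L * s) * (U s - gronwall_bound L lam q d s)).
  set (W' := fun s => L * exp (- L * s) * (phi s - U s)).
  assert (dW : forall s, is_derive W s (W' s)).
  { intros s. unfold W, gronwall_bound. auto_derive.
    - exists (g s); apply dU.
    - rewrite (is_derive_unique (fun x => U x) s (g s) (dU s)). unfold W', g. field. lra. }
  destruct (MVT_gen W 0 t W') as [c [hcr E]].
  - intros; apply dW.
  - intros s _. apply derivable_continuous_pt. exists (W' s). apply is_derive_Reals, dW.
  - rewrite Rmin_left // Rmax_right // in hcr.
    assert (n : W' c <= 0).
    { unfold W'. specialize (hi c ltac:(lra)). pose proof (exp_pos (- L * c)).
      assert (0 <= L * exp (- L * c)) by nra. nra. }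
    assert (w0 : W 0 = 0).
    { unfold W, gronwall_bound. rewrite U0 !Rmult_0_r exp_0. field. lra. }
    assert (w : W t <= 0) by nra.
    unfold W in w. pose proof (exp_pos (- L * t)). specialize (hi t ht). nra.
Qed.

(** [Phi] commutes with Riemann sums and is continuous, so it passes to the limit. *)
Lemma is_RInt_linear {U V : NormedModule R_AbsRing} (Phi : U -> V) (f : R -> U) a b I :
  is_linear Phi -> is_RInt f a b I -> is_RInt (fun s => Phi (f s)) a b (Phi I).
Proof.
  intros l h.
  apply (filterlim_ext (fun ptd => Phi (scal (sign (b - a)) (Riemann_sum f ptd)))).
  - intros ptd. rewrite (linear_scal _ l). f_equal.
    apply (SF_cons_ind (fun ptd => Phi (Riemann_sum f ptd) = Riemann_sum (fun s => Phi (f s)) ptd)).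
    + intros x. apply (linear_zero Phi l).
    + intros x p IH. rewrite !Riemann_sum_cons (linear_plus _ l) (linear_scal _ l) IH. reflexivity.
  - apply filterlim_comp with (1 := h). apply (linear_cont Phi I l).
Qed.

(** Mild solutions are continuous on nonnegative times only; freezing them at time 0 for negative
    arguments gives the two-sided continuity that [gronwall] asks for. *)
Lemma continuous_extend {V : UniformSpace} (v : R -> V) :
  (forall t, 0 <= t -> filterlim v (within (fun s => 0 <= s) (locally t)) (locally (v t))) ->
  forall t, continuous (fun s => v (Rmax 0 s)) t.
Proof.
  intros h t.
  apply filterlim_comp with (2 := h (Rmax 0 t) (Rmax_l 0 t)).
  intros Q [d hd]. exists d. intros y hy. apply hd; [|apply Rmax_l].
  revert hy. unfold ball; simpl. unfold AbsRing_ball, abs, minus, plus, opp; simpl.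
  unfold Rmax, Rabs. repeat destruct Rle_dec; repeat destruct Rcase_abs; lra.
Qed.

(** * Comparison of the two flows *)

Section Estimate.
Context {H : NormedModule R_AbsRing} {ip : H -> H -> R} (hip : inner_product ip).
Context (A : operator H) (hA : self_adjoint ip A) (hA0 : nonnegative ip A) (hAc : compact_resolvent A).
Context (hcomplete : complete_norm H) (hdim : infinite_dimensional H).
Context (F : H -> H) (M L : R) (hM : 0 < M) (hL : 0 < L)
  (hFM : forall u, norm (F u) <= M)
  (hFL : forall u w, norm (minus (F u) (F w)) <= L * norm (minus u w)).
Context (N eps : R) (hN : 0 < N) (heps : 0 < eps).
Context (P : H -> H) (hP : functional_calculus A (indicator 0 N) P).
Context (S Se : R -> H -> H) (hS : mild_semiflow A F S) (hSe : mild_semiflow (A_eps A P eps) F Se).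
Context (h : H -> H) (hh : inertial_manifold A F M L eps P Se h).

Let lp := lambda_plus A P.

Lemma lambda_plus_ge : N <= lp.
Proof. exact (proj1 (lambda_plus_bounds hip A hA hA0 hAc P N hP hcomplete hdim)). Qed.

Lemma alpha_pos : 0 < alpha A P eps.
Proof.
  unfold alpha. pose proof lambda_plus_ge as l. unfold lp in l. pose proof (Rinv_0_lt_compat eps heps). lra.
Qed.

(** An eigenvector of [A] is one of [A_eps], with its eigenvalue raised by [/ eps] exactly when it
    lies above [N]. Everything can thus be compared within the calculus of [A]. *)
Lemma fc_A_eps f Phi : functional_calculus (A_eps A P eps) f Phi ->
  functional_calculus A (fun nu => f (nu + / eps * (1 - indicator 0 N nu))) Phi.
Proof.
  intros [l E]. split; [exact l|]. intros nu e d he. apply E; [exact d|].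
  simpl. rewrite /compl he (proj2 hP nu e d he). vec hip.
Qed.

Lemma compl_semigroup_le E t x : 0 <= t ->
  functional_calculus A (fun nu => exp (- t * nu)) E ->
  norm (compl P (E x)) <= exp (- lp * t) * norm (compl P x).
Proof.
  intros ht hE. destruct hAc as (lam & G & hG & cG).
  rewrite -(Rabs_pos_eq (exp (- lp * t))); [|left; apply exp_pos].
  rewrite -(norm_scal_R hip).
  assert (hQ := fc_compl hip A _ _ hP).
  apply (fc_compare hip A hA lam G hG cG _ _ _ _ x (fc_comp hip A _ _ _ _ hQ hE)
    (fc_scal hip A (exp (- lp * t)) _ _ hQ)).
  intros nu e he n.
  destruct (indicator_nonneg N nu (eigenvalue_nonneg hip A hA0 nu e he n)) as [[_ ->]|[k ->]].
  - rewrite Rminus_diag Rmult_0_l Rmult_0_r. lra.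
  - pose proof (proj2 (lambda_plus_bounds hip A hA hA0 hAc P N hP hcomplete hdim) nu e k he n) as b.
    fold lp in b.
    rewrite Rminus_0_r Rmult_1_l Rmult_1_r !Rabs_pos_eq; [|left; apply exp_pos|left; apply exp_pos].
    apply exp_le. nra.
Qed.

Lemma compl_mild_le u0 t : 0 <= t ->
  norm (compl P (S t u0)) <= exp (- lp * t) * norm (compl P u0) + M / lp.
Proof.
  intros ht. pose proof lambda_plus_ge as l0.
  destruct hS as (E & hE & hm). destruct (hm u0) as [_ hI].
  destruct (hI t ht) as (I & iI & ->).
  assert (lQ := proj1 (fc_compl hip A _ _ hP)).
  rewrite (linear_plus _ lQ). eapply Rle_trans; [apply norm_triangle|].
  apply Rplus_le_compat; [apply compl_semigroup_le; auto|].
  (* This is the integral of [M * exp (- lp * (t - s))] written through its antiderivative. *)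
  apply Rle_trans with (M / lp * exp (- lp * (t - t)) - M / lp * exp (- lp * (t - 0))).
  - apply (norm_RInt_le (fun s => compl P (E (t - s) (F (S s u0))))
      (fun s => M * exp (- lp * (t - s))) 0 t); [exact ht| | |].
    + intros s hs. eapply Rle_trans; [apply compl_semigroup_le; [|apply hE]; lra|].
      rewrite Rmult_comm. apply Rmult_le_compat_r; [left; apply exp_pos|].
      eapply Rle_trans; [apply (norm_compl_le hip A hA hA0 hAc P N hP) | apply hFM].
    + exact (is_RInt_linear (compl P) _ _ _ _ lQ iI).
    + apply (is_RInt_derive (fun s => M / lp * exp (- lp * (t - s)))).
      * intros s _. auto_derive; [auto|]. rewrite /Rminus. field. lra.
      * intros s _. apply (ex_derive_continuous (fun s => M * exp (- lp * (t - s)))). auto_derive; auto.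
  - rewrite Rminus_diag Rmult_0_r exp_0. pose proof (exp_pos (- lp * (t - 0))).
    assert (0 < M / lp) by (apply Rdiv_lt_0_compat; lra). nra.
Qed.

(** The shift by [/ eps] vanishes where the indicator is 1. Keeping [P] on the right lets the same
    estimate cancel the initial data, whose projections agree, and control the integrands. *)
Lemma proj_semigroup_diff_le E E' t x y : 0 <= t ->
  functional_calculus A (fun nu => exp (- t * nu)) E ->
  functional_calculus (A_eps A P eps) (fun nu => exp (- t * nu)) E' ->
  norm (minus (P (E x)) (P (E' y))) <= norm (P (minus x y)).
Proof.
  intros ht hE hE'. apply fc_A_eps in hE'.
  assert (hPE := fc_comp hip A _ _ _ _ hP hE).
  assert (e : P (E' y) = P (E y)).
  { apply (fc_eq hip A hA hA0 hAc _ _ _ _ y (fc_comp hip A _ _ _ _ hP hE') hPE). intros nu k. simpl.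
    destruct (indicator_nonneg N nu k) as [[_ ->]|[_ ->]]; [|ring].
    rewrite Rminus_diag Rmult_0_r Rplus_0_r. reflexivity. }
  rewrite e -(linear_minus _ _ _ (proj1 hPE)).
  apply (fc_le hip A hA hA0 hAc _ _ _ _ _ hPE hP). intros nu k.
  assert (b : exp (- t * nu) <= 1) by (rewrite -exp_0; apply exp_le; nra).
  rewrite Rabs_mult (Rabs_pos_eq (exp _)); [|left; apply exp_pos].
  pose proof (Rabs_pos (indicator 0 N nu)). nra.
Qed.

Lemma manifold_proj x : manifold P h x -> x = retraction P h x.
Proof.
  intros (p & hp & ->). unfold retraction.
  pose proof (im_range hh hp) as r. apply (range_compl hip A hA hA0 hAc P N hP) in r.
  apply (range_proj hip A hA hA0 hAc P N hP) in hp.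
  rewrite (linear_plus _ (proj1 hP)) hp r.
  rewrite (_ : plus p zero = p); [reflexivity | vec hip].
Qed.

Lemma flow_on_manifold u0 t : 0 <= t ->
  Se t (retraction P h u0) = retraction P h (Se t (retraction P h u0)).
Proof.
  intros ht. apply manifold_proj. apply (im_invariant hh ht).
  exists (retraction P h u0). split; [|reflexivity].
  exists (P u0). split; [exists u0; reflexivity | reflexivity].
Qed.

Lemma proj_retraction u : P (retraction P h u) = P u.
Proof.
  unfold retraction. rewrite (linear_plus _ (proj1 hP)) (proj_idem hip A hA hA0 hAc P N hP).
  assert (r : range P (P u)) by (exists u; reflexivity).
  rewrite (proj1 (range_compl hip A hA hA0 hAc P N hP _) (im_range hh r)). vec hip.
Qed.

Lemma retraction_diff_le u w : 0 < gamma A P eps ->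
  norm (minus (retraction P h u) (retraction P h w)) <= c_eps A P L eps * norm (minus (P u) (P w)).
Proof.
  intros hg. set (g := gamma A P eps) in *.
  assert (ru : range P (P u)) by (exists u; reflexivity).
  assert (rw : range P (P w)) by (exists w; reflexivity).
  pose proof (im_lip hh ru rw) as lip. fold g in lip.
  set (p := minus (P u) (P w)) in *. set (q := minus (h (P u)) (h (P w))) in *.
  assert (E : minus (retraction P h u) (retraction P h w) = plus p q) by (unfold retraction, p, q; vec hip).
  rewrite E.
  assert (sq : norm (plus p q) ^ 2 = norm p ^ 2 + norm q ^ 2).
  { apply (norm_sq_proj_compl hip A hA hA0 hAc P N hP).
    - unfold p. rewrite (linear_minus _ _ _ (proj1 hP)) !(proj_idem hip A hA hA0 hAc P N hP). reflexivity.
    - unfold q. rewrite (linear_minus _ _ _ (proj1 hP)).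
      rewrite (proj1 (range_compl hip A hA hA0 hAc P N hP _) (im_range hh ru)).
      rewrite (proj1 (range_compl hip A hA hA0 hAc P N hP _) (im_range hh rw)). vec hip. }
  assert (c0 : 0 <= 16 * L ^ 2 / g ^ 2).
  { apply Rdiv_le_0_compat; [nra | apply pow_lt, hg]. }
  apply Rsqr_incr_0_var.
  - rewrite Rsqr_mult /c_eps Rsqr_sqrt; [|fold g; lra]. rewrite !Rsqr_pow2 sq. fold g.
    assert (norm q ^ 2 <= (4 * L / g * norm p) ^ 2) by (apply pow_incr; split; [apply norm_ge_0 | exact lip]).
    replace ((1 + 16 * L ^ 2 / g ^ 2) * norm p ^ 2) with (norm p ^ 2 + (4 * L / g * norm p) ^ 2) by (field; lra).
    lra.
  - apply Rmult_le_pos; [apply sqrt_pos | apply norm_ge_0].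
Qed.

(** The triangle inequality is used here instead of Pythagoras because Gronwall needs a bound linear
    in the gap of the projections. *)
Lemma flow_gap_le u0 s : 0 <= s ->
  norm (minus (S s u0) (Se s (retraction P h u0))) <=
  norm (minus (P (S s u0)) (P (Se s (retraction P h u0)))) +
  (exp (- lp * s) * norm (compl P u0) + d_eps A P M eps).
Proof.
  intros hs. rewrite {1}(flow_on_manifold u0 s hs). set (w := Se s (retraction P h u0)).
  rewrite (_ : minus (S s u0) (retraction P h w) =
    plus (minus (P (S s u0)) (P w)) (minus (compl P (S s u0)) (h (P w)))); [|unfold retraction, compl; vec hip].
  eapply Rle_trans; [apply norm_triangle|]. apply Rplus_le_compat_l.
  unfold minus. eapply Rle_trans; [apply norm_triangle|]. rewrite norm_opp.
  assert (rw : range P (P w)) by (exists w; reflexivity).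
  pose proof (im_bound hh rw). pose proof (compl_mild_le u0 s hs). unfold d_eps. fold lp. lra.
Qed.

(** The gap enters as a function [phi] continuous on the whole line, to be instantiated with the
    extension frozen at time 0. *)
Lemma proj_gap_integral_le u0 (phi : R -> R) t : 0 <= t ->
  (forall s, continuous phi s) ->
  (forall s, 0 <= s -> norm (minus (P (S s u0)) (P (Se s (retraction P h u0)))) = phi s) ->
  phi t <= RInt (fun s => L * (phi s + (exp (- lp * s) * norm (compl P u0) + d_eps A P M eps))) 0 t.
Proof.
  intros ht pc pe. rewrite -pe //.
  destruct hS as (E & hE & hm). destruct (hm u0) as [_ hI].
  destruct (hI t ht) as (I & iI & eI).
  destruct hSe as (E' & hE' & hm'). destruct (hm' (retraction P h u0)) as [_ hI'].
  destruct (hI' t ht) as (I' & iI' & eI').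
  rewrite eI eI' !(linear_plus _ (proj1 hP)).
  rewrite (_ : minus (plus (P (E t u0)) (P I)) (plus (P (E' t (retraction P h u0))) (P I')) =
     plus (minus (P (E t u0)) (P (E' t (retraction P h u0)))) (minus (P I) (P I'))); [|vec hip].
  eapply Rle_trans; [apply norm_triangle|].
  assert (z : norm (minus (P (E t u0)) (P (E' t (retraction P h u0)))) <= 0).
  { eapply Rle_trans; [apply (proj_semigroup_diff_le _ _ t); auto|].
    rewrite (linear_minus _ _ _ (proj1 hP)) proj_retraction.
    rewrite (_ : minus (P u0) (P u0) = zero); [rewrite norm_zero; lra | vec hip]. }
  enough (norm (minus (P I) (P I')) <=
    RInt (fun s => L * (phi s + (exp (- lp * s) * norm (compl P u0) + d_eps A P M eps))) 0 t) by lra.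
  apply (norm_RInt_le
    (fun s => minus (P (E (t - s) (F (S s u0)))) (P (E' (t - s) (F (Se s (retraction P h u0))))))
    (fun s => L * (phi s + (exp (- lp * s) * norm (compl P u0) + d_eps A P M eps))) 0 t); [exact ht| | |].
  - intros s hs. eapply Rle_trans; [apply (proj_semigroup_diff_le _ _ (t - s)); [|apply hE|apply hE']; lra|].
    eapply Rle_trans; [apply (norm_proj_le hip A hA hA0 hAc P N hP)|].
    eapply Rle_trans; [apply hFL|]. apply Rmult_le_compat_l; [lra|].
    rewrite -pe; [|lra]. apply flow_gap_le. lra.
  - apply (is_RInt_minus (V := H)); apply is_RInt_linear; try apply hP; assumption.
  - apply (RInt_correct (V := R_CompleteNormedModule)), (ex_RInt_continuous (V := R_CompleteNormedModule)).
    intros s _.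
    apply (continuous_mult (fun _ => L)); [apply continuous_const|].
    apply (continuous_plus phi); [apply pc|].
    apply (ex_derive_continuous (fun s => exp (- lp * s) * norm (compl P u0) + d_eps A P M eps)).
    auto_derive; auto.
Qed.

Lemma proj_gap_le u0 t : 0 <= t ->
  norm (minus (P (S t u0)) (P (Se t (retraction P h u0)))) <=
  gronwall_bound L lp (norm (compl P u0)) (d_eps A P M eps) t.
Proof.
  intros ht. set (w0 := retraction P h u0).
  set (phi := fun s => norm (minus (P (S (Rmax 0 s) u0)) (P (Se (Rmax 0 s) w0)))).
  assert (pe : forall s, 0 <= s -> norm (minus (P (S s u0)) (P (Se s w0))) = phi s).
  { intros s hs. unfold phi. rewrite Rmax_right //. }
  assert (pc : forall s, continuous phi s).
  { intros s. unfold phi.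
    apply (continuous_comp (fun s => minus (P (S (Rmax 0 s) u0)) (P (Se (Rmax 0 s) w0))) norm);
      [|apply filterlim_norm].
    destruct hS as (E & _ & hm). destruct hSe as (E' & _ & hm').
    apply (continuous_minus (V := H)).
    - apply (continuous_comp (fun s => S (Rmax 0 s) u0) P); [|apply linear_cont, hP].
      apply (continuous_extend (fun s => S s u0)), hm.
    - apply (continuous_comp (fun s => Se (Rmax 0 s) w0) P); [|apply linear_cont, hP].
      apply (continuous_extend (fun s => Se s w0)), hm'. }
  rewrite pe //. pose proof lambda_plus_ge.
  apply gronwall; [exact hL | lra | exact pc | | exact ht].
  intros s hs. apply proj_gap_integral_le; assumption.
Qed.

Lemma flow_error_le u0 t T : 0 <= t <= T -> 0 < gamma A P eps ->
  norm (minus (retraction P h (S t u0)) (Se t (retraction P h u0))) <=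
  c_eps A P L eps * gronwall_bound L lp (norm (compl P u0)) (d_eps A P M eps) T.
Proof.
  intros ht hg. rewrite flow_on_manifold; [|lra].
  eapply Rle_trans; [apply retraction_diff_le, hg|].
  apply Rmult_le_compat_l; [apply sqrt_pos|].
  eapply Rle_trans; [apply proj_gap_le; lra|].
  pose proof lambda_plus_ge. pose proof alpha_pos.
  apply gronwall_bound_mono; try lra; [apply norm_ge_0|].
  unfold d_eps. fold lp.
  assert (0 < M / lp) by (apply Rdiv_lt_0_compat; lra).
  assert (0 < M / alpha A P eps) by (apply Rdiv_lt_0_compat; lra). lra.
Qed.

(** All denominators [lp], [alpha] and [L + lp] are at least [N], so each term of the bound carries
    a factor [/ N]. *)
Lemma flow_error_uniform u0 r t T : 8 * L <= gamma A P eps -> norm u0 <= r -> 0 <= t <= T ->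
  norm (minus (retraction P h (S t u0)) (Se t (retraction P h u0))) <=
  2 * (L * exp (L * T) * r + 2 * M * (exp (L * T) - 1)) / N.
Proof.
  intros hg hr ht. eapply Rle_trans; [apply (flow_error_le u0 t T ht); lra|].
  pose proof lambda_plus_ge as l0. pose proof alpha_pos as a0.
  (* The gap condition makes the fraction under the root at most one quarter. *)
  assert (c2 : c_eps A P L eps <= 2).
  { unfold c_eps. rewrite -(sqrt_Rsqr 2); [|lra]. apply sqrt_le_1_alt. unfold Rsqr.
    assert (g2 : 0 < gamma A P eps ^ 2) by (apply pow_lt; lra).
    apply Rmult_le_reg_r with (gamma A P eps ^ 2); [exact g2|].
    rewrite Rmult_plus_distr_r /Rdiv Rmult_assoc Rinv_l; [|lra].
    assert (8 * L * (8 * L) <= gamma A P eps ^ 2) by (simpl; nra). nra. }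
  assert (al : lp <= alpha A P eps).
  { unfold alpha. fold lp. pose proof (Rinv_0_lt_compat eps heps). lra. }
  assert (e1 : 1 <= exp (L * T)) by (rewrite -exp_0; apply exp_le; nra).
  assert (i1 : / lp <= / N) by (apply Rinv_le_contravar; lra).
  assert (i2 : / alpha A P eps <= / N) by (apply Rinv_le_contravar; lra).
  assert (i3 : / (L + lp) <= / N) by (apply Rinv_le_contravar; lra).
  assert (i4 : 0 < / N) by (apply Rinv_0_lt_compat, hN).
  assert (i5 : 0 < / (L + lp)) by (apply Rinv_0_lt_compat; lra).
  assert (i6 : 0 < / lp) by (apply Rinv_0_lt_compat; lra).
  assert (i7 : 0 < / alpha A P eps) by (apply Rinv_0_lt_compat; lra).
  assert (e2 : exp (- lp * T) <= 1) by (rewrite -exp_0; apply exp_le; nra).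
  pose proof (exp_pos (- lp * T)) as e3.
  assert (b : 0 <= gronwall_bound L lp (norm (compl P u0)) (d_eps A P M eps) T
            <= (L * exp (L * T) * r + 2 * M * (exp (L * T) - 1)) * / N).
  { pose proof (norm_ge_0 (compl P u0)) as q0.
    pose proof (norm_compl_le hip A hA hA0 hAc P N hP u0) as q1.
    assert (d1 : 0 <= d_eps A P M eps <= 2 * M * / N).
    { unfold d_eps, Rdiv. fold lp. split; nra. }
    unfold gronwall_bound, Rdiv.
    assert (x1 : 0 <= L * (exp (L * T) - exp (- lp * T)) * / (L + lp) <= L * exp (L * T) * / N).
    { split; [apply Rmult_le_pos; nra|]. apply Rmult_le_compat; nra. }
    assert (x2 : L * (exp (L * T) - exp (- lp * T)) * / (L + lp) * norm (compl P u0) <= L * exp (L * T) * / N * r).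
    { apply Rmult_le_compat; lra. }
    assert (x3 : (exp (L * T) - 1) * d_eps A P M eps <= (exp (L * T) - 1) * (2 * M * / N)).
    { apply Rmult_le_compat_l; lra. }
    split; [|nra]. apply Rplus_le_le_0_compat; apply Rmult_le_pos; lra. }
  unfold Rdiv. rewrite Rmult_assoc. apply Rmult_le_compat; try lra. apply sqrt_pos.
Qed.
End Estimate.

Theorem theorem4p5
  (H : CompleteNormedModule R_AbsRing) (ip : H -> H -> R)
  (hip : inner_product ip) (hdim : infinite_dimensional H)
  (A : operator H)
  (hA : self_adjoint ip A) (hA0 : nonnegative ip A) (hAc : compact_resolvent A)
  (F : H -> H) (M L mu : R) (hM : 0 < M) (hL : 0 < L) (hmu : 0 < mu)
  (hFM : forall u, norm (F u) <= M)
  (hFL : forall u w, norm (minus (F u) (F w)) <= L * norm (minus u w))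
  (P : R -> H -> H)
  (hP : forall eps, 0 < eps <= 1 ->
     functional_calculus A (indicator 0 (Lambda mu eps)) (P eps))
  (S : R -> H -> H) (hS : mild_semiflow A F S)
  (Se : R -> R -> H -> H)
  (hSe : forall eps, 0 < eps <= 1 ->
     mild_semiflow (A_eps A (P eps) eps) F (Se eps))
  (h : R -> H -> H)
  (hh : forall eps, 0 < eps <= 1 -> 8 * L <= gamma A (P eps) eps ->
     inertial_manifold A F M L eps (P eps) (Se eps) (h eps)) :
  (forall eps, 0 < eps <= 1 -> 8 * L <= gamma A (P eps) eps ->
   forall T u0, 0 < T ->
     Rbar_le
       (Lub_Rbar (fun x => exists t, 0 <= t <= T /\
          x = norm (minus (retraction (P eps) (h eps) (S t u0))
                          (Se eps t (retraction (P eps) (h eps) u0)))))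
       (c_eps A (P eps) L eps *
         (L * (exp (L * T) - exp (- lambda_plus A (P eps) * T))
            / (L + lambda_plus A (P eps)) * norm (compl (P eps) u0)
          + (exp (L * T) - 1) * d_eps A (P eps) M eps)))
  /\
  (forall B : H -> Prop, bounded_set B -> forall T, 0 < T ->
   exists C : R, forall eps, 0 < eps <= 1 -> 8 * L <= gamma A (P eps) eps ->
     Rbar_le
       (Lub_Rbar (fun x => exists u0 t, B u0 /\ 0 <= t <= T /\
          x = norm (minus (retraction (P eps) (h eps) (S t u0))
                          (Se eps t (retraction (P eps) (h eps) u0)))))
       (C * eps ^ 2)).
Proof.
  assert (hc := complete_normed_module H).
  assert (hL0 : forall eps, 0 < eps <= 1 -> 0 < Lambda mu eps).
  { intros eps he. apply Rdiv_lt_0_compat; [exact hmu | apply pow_lt; lra]. }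
  split.
  - intros eps he hg T u0 hT. apply (proj2 (Lub_Rbar_correct _)).
    intros x (t & ht & ->).
    apply (flow_error_le hip A hA hA0 hAc hc hdim F M L hM hL hFM hFL (Lambda mu eps) eps
      (hL0 eps he) (proj1 he) (P eps) (hP eps he) S (Se eps) hS (hSe eps he) (h eps) (hh eps he hg));
      [exact ht | lra].
  - intros B [r hr] T hT.
    (* With [N = Lambda mu eps] the factor [/ N] is [eps ^ 2 / mu]; the rest depends only on the
       radius [r] of [B], on [T] and on the fixed constants. *)
    exists (2 * (L * exp (L * T) * r + 2 * M * (exp (L * T) - 1)) / mu).
    intros eps he hg. apply (proj2 (Lub_Rbar_correct _)).
    intros x (u0 & t & hB & ht & ->). simpl.
    replace (2 * (L * exp (L * T) * r + 2 * M * (exp (L * T) - 1)) / mu * (eps * (eps * 1)))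
      with (2 * (L * exp (L * T) * r + 2 * M * (exp (L * T) - 1)) / Lambda mu eps)
      by (unfold Lambda; field; lra).
    apply (flow_error_uniform hip A hA hA0 hAc hc hdim F M L hM hL hFM hFL (Lambda mu eps) eps
      (hL0 eps he) (proj1 he) (P eps) (hP eps he) S (Se eps) hS (hSe eps he) (h eps) (hh eps he hg));
      auto.
Qed.
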